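(* Let $W$ be a $\mathbb{Z}_2$-graded complex vector space of dimension $2|1$ (two even, one odd dimension). Let $d=d_1+d_2+\cdots$ be a codifferential on $S(W)$ with $d_1\neq 0$, that is, a codifferential whose leading term $d_1$ has degree $1$. Then $d$ is equivalent to the codifferential $d_1$ given by its leading term alone.
   Context: $S(W)=\bigoplus_{n\ge 1}S^n(W)$ is the ($\mathbb{Z}_2$-graded) symmetric coalgebra of $W$. Put $L_n=\mathrm{Hom}(S^n(W),W)$ and $L=\mathrm{Hom}(S(W),W)=\prod_{n\ge1}L_n$, identified with the space $\mathrm{Coder}(S(W))$ of coderivations of $S(W)$. $L$ is a $\mathbb{Z}_2$-graded Lie algebra under the graded commutator $[\cdot,\cdot]$ of coderivations. Elements of $L_n$ are said to have degree $n$. A codifferential (an $L_\infty$ structure on $W$) is an odd element $d=d_1+d_2+\cdots\in L$, $d_i\in L_i$, with $[d,d]=0$. Its leading term is its first nonvanishing component $d_N$, which is itself a codifferential. A coalgebra automorphism $g$ of $S(W)$ is determined by an even element $g_1+g_2+\cdots$ of $\mathrm{Hom}(S(W),W)$ with $g_i\in \mathrm{Hom}(S^i(W),W)$ and $g_1:W\to W$ invertible. Two codifferentials $d,d'$ are equivalent if $d'=g^*(d):=g^{-1}dg$ for some coalgebra automorphism $g$ of $S(W)$. *)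

(* Defs.v *)
From HB Require Import structures.
From mathcomp Require Import all_boot all_order all_algebra.
From mathcomp Require Import finmap.
From mathcomp Require Import reals complex.
From mathcomp Require Import monalg.

Set Implicit Arguments.
Unset Strict Implicit.
Unset Printing Implicit Defensive.

Import GRing.Theory.
Local Open Scope ring_scope.

(* The reduced symmetric coalgebra S(W) of a super vector space W = W0 (+) W1,
   with p = dim W0 and q = dim W1, is presented through a homogeneous basis
   e_0, .., e_(p-1) of W0 and t_0, .., t_(q-1) of W1: a basis of S(W) is given
   by the monomials  e^a t_A = \prod_i e_i^(a i) \prod_(j in A) t_j  (odd
   factors in increasing order) with (a, A) <> (0, set0), the latter exclusion
   because S(W) starts with S^1(W). *)

Definition smon0 (p q : nat) : {ffun 'I_p -> nat} * {set 'I_q} :=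
  ([ffun=> 0%N], set0).

Definition smon (p q : nat) : choiceType :=
  {m : {ffun 'I_p -> nat} * {set 'I_q} | m != smon0 p q}.

Definition sparity p q (m : smon p q) : bool := odd #|(val m).2|.

(* e^a t_A lies in S^n(W) for n = sdeg (a, A). *)
Definition sdeg p q (m : smon p q) : nat :=
  (\sum_i (val m).1 i + #|(val m).2|)%N.

Definition symc (K : fieldType) (p q : nat) : lmodType K :=
  {malg K[smon p q]}.

(* S(W) (x) S(W), with basis the pairs of monomials. *)
Definition symc2 (K : fieldType) (p q : nat) : lmodType K :=
  {malg K[(smon p q * smon p q)%type]}.

Section SymmetricCoalgebra.
Variables (K : fieldType) (p q : nat).
Local Notation S := (symc K p q).
Local Notation S2 := (symc2 K p q).

(* e^a t_A as an element of S(W); the empty monomial is sent to 0. *)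
Definition smonE (m : {ffun 'I_p -> nat} * {set 'I_q}) : S :=
  oapp (fun m' : smon p q => << m' >>) 0 (insub m).

Definition scoef (x : S) (m : {ffun 'I_p -> nat} * {set 'I_q}) : K :=
  oapp (fun m' : smon p q => x@_m') 0 (insub m).

Definition stens (x y : S) : S2 :=
  \sum_(m <- msupp x) \sum_(n <- msupp y) (x@_m * y@_n) *: << (m, n) >>.

(* t_B t_C = koszul B C * t_(B :|: C) for disjoint B, C. *)
Definition koszul (B C : {set 'I_q}) : K :=
  (-1) ^+ #|[set u : 'I_q * 'I_q | [&& u.1 \in B, u.2 \in C & (u.2 < u.1)%N]]|.

(* The coproduct: each e_i and t_j being primitive, the unreduced coproduct of
   e^a t_A is \prod_i (e_i (x) 1 + 1 (x) e_i)^(a i)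
   \prod_(j in A) (t_j (x) 1 + 1 (x) t_j), the products being taken in the
   graded tensor square. The two terms with an empty factor vanish by smonE. *)
Definition scomul_mon (m : smon p q) : S2 :=
  let a := (val m).1 in let A := (val m).2 in
  \sum_(b : {dffun forall i : 'I_p, 'I_(a i).+1})
  \sum_(B in powerset A)
    ((\prod_i 'C(a i, b i))%:R * koszul B (A :\: B)) *:
      stens (smonE ([ffun i => nat_of_ord (b i)], B))
            (smonE ([ffun i => (a i - b i)%N], A :\: B)).

Definition scomul (x : S) : S2 := \sum_(m <- msupp x) x@_m *: scomul_mon m.

(* f (x) g for a map g of parity k:
   (f (x) g)(x (x) y) = (-1)^(k |x|) f x (x) g y. *)
Definition stensmap (k : bool) (f g : S -> S) (z : S2) : S2 :=
  \sum_(u <- msupp z)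
    (z@_u * (-1) ^+ (k && sparity u.1)) *: stens (f << u.1 >>) (g << u.2 >>).

Definition homog (k : bool) (f : S -> S) : Prop :=
  forall m n : smon p q, (f << m >>)@_n != 0 -> sparity n = sparity m (+) k.

Definition coderivation (k : bool) (D : {linear S -> S}) : Prop :=
  homog k D /\
  forall x, scomul (D x) =
    stensmap false D idfun (scomul x) + stensmap k idfun D (scomul x).

(* The graded commutator of coderivations D, E of parities k, l. *)
Definition cobracket (k l : bool) (D E : {linear S -> S}) (x : S) : S :=
  D (E x) - (-1) ^+ (k && l) *: E (D x).

Definition codifferential (d : {linear S -> S}) : Prop :=
  coderivation true d /\ forall x, cobracket true true d d x = 0.

Definition coalg_aut (g : {linear S -> S}) (gi : S -> S) : Prop :=
  [/\ homog false g,
      forall x, scomul (g x) = stensmap false g g (scomul x),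
      cancel g gi & cancel gi g].

(* d' = g^-1 d g for some automorphism g. *)
Definition coequiv (d d' : {linear S -> S}) : Prop :=
  exists (g : {linear S -> S}) (gi : S -> S),
    coalg_aut g gi /\ forall x, d' x = gi (d (g x)).

(* The projection of S(W) onto S^n(W). *)
Definition sproj (n : nat) (x : S) : S :=
  \sum_(m <- msupp x | sdeg m == n) x@_m *: << m >>.

End SymmetricCoalgebra.

Section Components.
Variables (K : fieldType) (W : vectType K) (W0 W1 : {vspace W}).
Local Notation S := (symc K (\dim W0) (\dim W1)).

(* The projection of S(W) onto S^1(W) = W; the homogeneous basis of W is
   vbasis W0 followed by vbasis W1. *)
Definition scorestr (x : S) : W :=
  \sum_(i < \dim W0)
     scoef x ([ffun j => nat_of_bool (j == i)], set0) *: (vbasis W0)`_i +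
  \sum_(j < \dim W1) scoef x ([ffun=> 0%N], [set j]) *: (vbasis W1)`_j.

(* A coderivation D is determined by scorestr \o D in L = Hom(S(W), W). This is
   its component D_n in L_n = Hom(S^n(W), W), seen in L as the map that vanishes
   on S^k(W) for k <> n. *)
Definition component (n : nat) (D : {linear S -> S}) (x : S) : W :=
  scorestr (D (sproj n x)).

End Components.

Arguments scorestr {K W} W0 W1 x.
Arguments component {K W} W0 W1 n D x.

(* Main.v *)
(* Write S(W) = U (+) U t with U = S(W0) unreduced and t spanning W1. An odd
   coderivation D amounts to a coderivation V of U, with D (x t) = V x, and a
   contraction H of U (an operator commuting with all contractions), with
   D x = (H x) t; D is a codifferential iff V H = H V = 0. Dually, D is the odd
   vector field t V + h d/dt and V H = 0 says h V = 0.
   If V 1 <> 0, then H = 0 and V is to be straightened to the constant vector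
   field T = V 1; if h has a nonzero linear part l, then V = 0 and h is to be
   made a coordinate. Choose a vector v and a linear form l with l(v) = 1, let
   T be multiplication by v and A contraction with l, so that [A, T] = 1. With
     R = \sum_i (-1)^i T^i A^i / i!,
   which is S of the projection along v onto ker l, the coalgebra maps
     \sum_i V^i R A^i / i!   and   \sum_i T^i R H^i / i!
   intertwine T with V, respectively H with A. Both differ from
   \sum_i T^i R A^i / i! = id by terms of lower degree, hence are invertible,
   and they give the equivalence of D with its linear part. *)

Require Import Defs.
From HB Require Import structures.
From mathcomp Require Import all_boot all_order all_algebra.
From mathcomp Require Import finmap.
From mathcomp Require Import reals complex.
From mathcomp Require Import monalg.

Set Implicit Arguments.
Unset Strict Implicit.
Unset Printing Implicit Defensive.

Import GRing.Theory Num.Theory.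
Local Open Scope ring_scope.

Local Notation malg2 K A B := {malg K[(A * B)%type]}.

(* Unlike [linearP] and [linearZ], these leave a plain [*:%R] after rewriting. *)
Lemma linear_PZ (K : fieldType) (U V : lmodType K) (f : {linear U -> V}) c x y :
  f (c *: x + y) = c *: f x + f y.
Proof. exact: linearP. Qed.

Lemma linear_Z (K : fieldType) (U V : lmodType K) (f : {linear U -> V}) c x :
  f (c *: x) = c *: f x.
Proof. exact: linearZ. Qed.

HB.lock Definition lext (K : fieldType) (A : choiceType) (V : lmodType K)
    (f : A -> V) (x : {malg K[A]}) : V :=
  \sum_(a <- msupp x) x@_a *: f a.

(** * Linear maps and tensors on free modules *)

Section LinearExtension.
Variables (K : fieldType) (A : choiceType).
Implicit Types (x y : {malg K[A]}).

(** Reduces an identity that is linear in [x] to basis elements; many linear identities below are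
    proved in this way. *)
Lemma malg_lin_ind (P : {malg K[A]} -> Prop) :
  P 0 -> (forall c x y, P x -> P y -> P (c *: x + y)) ->
  (forall a, P << a >>) -> forall x, P x.
Proof.
move=> P0 Plin PU x; rewrite [x]monalgE.
have PZ c a : P (<< c *g a >>).
  rewrite (_ : << c *g a >> = c *: << a >> + 0 :> {malg K[A]}); first exact: Plin.
  by apply/malgP => b; rewrite addr0 mcoeffZ !mcoeffU mulrnAr mulr1.
elim/big_rec: _ => // a y _ Py.
by rewrite -[X in P (X + _)]scale1r; apply: Plin.
Qed.

Lemma lextEw (V : lmodType K) (f : A -> V) x (D : {fset A}) :
  (msupp x `<=` D)%fset -> lext f x = \sum_(a <- D) x@_a *: f a.
Proof.
rewrite lext.unlock => sub; apply: big_fset_incl => // a _.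
by move=> /mcoeff_outdom ->; rewrite scale0r.
Qed.

Lemma lext_is_linear (V : lmodType K) (f : A -> V) : linear (lext f).
Proof.
(* [D] contains all three supports, so that the sums for [x], [y] and their combination run over one
   index set. *)
move=> c x y; pose D := (msupp x `|` msupp y `|` msupp (c *: x + y))%fset.
rewrite !(@lextEw _ _ _ D); last 3 first.
- by rewrite /D -fsetUA fsubsetU // fsubsetUl orbT.
- by rewrite /D fsubsetU // fsubsetUl.
- by rewrite /D fsubsetUr.
rewrite scaler_sumr -big_split; apply: eq_bigr => a _ /=.
by rewrite mcoeffD mcoeffZ scalerDl scalerA.
Qed.

HB.instance Definition _ (V : lmodType K) (f : A -> V) :=
  GRing.isLinear.Build K {malg K[A]} V _ (lext f) (lext_is_linear f).

Lemma lextU (V : lmodType K) (f : A -> V) a : lext f << a >> = f a.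
Proof.
rewrite (lextEw _ (D := [fset a]%fset)) ?msuppU_le //.
by rewrite big_seq_fset1 mcoeffUU scale1r.
Qed.

Lemma eq_lext (V : lmodType K) (f g : A -> V) :
  f =1 g -> lext f =1 lext g.
Proof. by move=> eqfg x; rewrite lext.unlock; apply: eq_bigr => a _; rewrite eqfg. Qed.

Lemma linear_lext (V : lmodType K) (f : {linear {malg K[A]} -> V}) x :
  f x = lext (fun a => f << a >>) x.
Proof.
elim/malg_lin_ind: x => [|c x y|a]; first by rewrite !linear0.
  by rewrite !linear_PZ /= => -> ->.
by rewrite lextU.
Qed.

Lemma malg_ext (V : lmodType K) (f g : {linear {malg K[A]} -> V}) :
  (forall a, f << a >> = g << a >>) -> f =1 g.
Proof. by move=> e x; rewrite linear_lext [RHS]linear_lext; apply: eq_lext. Qed.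

End LinearExtension.

HB.lock Definition tens (K : fieldType) (A B : choiceType)
    (x : {malg K[A]}) (y : {malg K[B]}) : (malg2 K A B) :=
  lext (fun a => lext (fun b => << (a, b) >>) y) x.

(** The tensor product of maps without Koszul sign; the sign enters later, in [smap]. *)
HB.lock Definition tmap (K : fieldType) (A B A' B' : choiceType)
    (f : {malg K[A]} -> {malg K[A']}) (g : {malg K[B]} -> {malg K[B']})
    (z : (malg2 K A B)) : (malg2 K A' B') :=
  lext (fun u => tens (f << u.1 >>) (g << u.2 >>)) z.

Section Tensor.
Variable K : fieldType.

Lemma tensE (A B : choiceType) (x : {malg K[A]}) (y : {malg K[B]}) a b :
  (tens x y)@_(a, b) = x@_a * y@_b.
Proof.
rewrite tens.unlock; elim/malg_lin_ind: x => [|c x1 x2 IH1 IH2|a'].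
- by rewrite linear0 !mcoeff0 mul0r.
- by rewrite linear_PZ !mcoeffD !mcoeffZ IH1 IH2 mulrDl mulrA.
rewrite lextU; elim/malg_lin_ind: y => [|c y1 y2 IH1 IH2|b'].
- by rewrite linear0 !mcoeff0 mulr0.
- by rewrite linear_PZ !mcoeffD !mcoeffZ IH1 IH2 mulrDr mulrCA.
rewrite lextU !mcoeffU xpair_eqE.
by case: (a' == a); case: (b' == b); rewrite ?mulr0 ?mul0r ?mulr1.
Qed.

Lemma malg2P (A B : choiceType) (x y : (malg2 K A B)) :
  (forall a b, x@_(a, b) = y@_(a, b)) -> x = y.
Proof. by move=> h; apply/malgP => -[a b]. Qed.

Section Bilinear.
Variables A B : choiceType.
Implicit Types (x : {malg K[A]}) (y : {malg K[B]}).

Lemma tensPl c x1 x2 y : tens (c *: x1 + x2) y = c *: tens x1 y + tens x2 y.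
Proof.
by apply: malg2P => a b; rewrite mcoeffD mcoeffZ !tensE mcoeffD mcoeffZ mulrDl -mulrA.
Qed.

Lemma tensPr c x y1 y2 : tens x (c *: y1 + y2) = c *: tens x y1 + tens x y2.
Proof.
apply: malg2P => a b; rewrite mcoeffD mcoeffZ !tensE mcoeffD mcoeffZ mulrDr.
by congr (_ + _); rewrite mulrCA.
Qed.

Lemma tens0l y : tens (0 : {malg K[A]}) y = 0.
Proof. by rewrite tens.unlock linear0. Qed.

Lemma tens0r x : tens x (0 : {malg K[B]}) = 0.
Proof. by apply: malg2P => a b; rewrite tensE !mcoeff0 mulr0. Qed.

Lemma tensZl c x y : tens (c *: x) y = c *: tens x y.
Proof. by rewrite -[c *: x]addr0 tensPl tens0l addr0. Qed.

Lemma tensZr c x y : tens x (c *: y) = c *: tens x y.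
Proof. by rewrite -[c *: y]addr0 tensPr tens0r addr0. Qed.

Lemma tens_suml I (r : seq I) (F : I -> {malg K[A]}) y :
  tens (\sum_(i <- r) F i) y = \sum_(i <- r) tens (F i) y.
Proof.
elim/big_rec2: _ => [|i u v _ <-]; first exact: tens0l.
by rewrite -[F i]scale1r tensPl !scale1r.
Qed.

Lemma tens_sumr I (r : seq I) x (F : I -> {malg K[B]}) :
  tens x (\sum_(i <- r) F i) = \sum_(i <- r) tens x (F i).
Proof.
elim/big_rec2: _ => [|i u v _ <-]; first exact: tens0r.
by rewrite -[F i]scale1r tensPr !scale1r.
Qed.

Lemma tensU a b : tens (<< a >> : {malg K[A]}) (<< b >> : {malg K[B]}) = << (a, b) >>.
Proof. by rewrite tens.unlock !lextU. Qed.

End Bilinear.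

Lemma tmap_is_linear (A B A' B' : choiceType) (f : {malg K[A]} -> {malg K[A']})
    (g : {malg K[B]} -> {malg K[B']}) : linear (tmap f g).
Proof. by rewrite tmap.unlock => c x y; rewrite linear_PZ. Qed.

HB.instance Definition _ (A B A' B' : choiceType) (f : {malg K[A]} -> {malg K[A']})
    (g : {malg K[B]} -> {malg K[B']}) :=
  GRing.isLinear.Build K (malg2 K A B) (malg2 K A' B') _ (tmap f g)
    (tmap_is_linear f g).

Section Tmap.
Variables (A B A' B' : choiceType).

Lemma tmapU (f : {malg K[A]} -> {malg K[A']}) (g : {malg K[B]} -> {malg K[B']}) a b :
  tmap f g << (a, b) >> = tens (f << a >>) (g << b >>).
Proof. by rewrite tmap.unlock lextU. Qed.

Lemma tmap_tens (f : {linear {malg K[A]} -> {malg K[A']}})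
    (g : {linear {malg K[B]} -> {malg K[B']}}) x y :
  tmap f g (tens x y) = tens (f x) (g y).
Proof.
elim/malg_lin_ind: x => [|c x1 x2 IH1 IH2|a].
- by rewrite tens0l !linear0 tens0l.
- by rewrite tensPl !linear_PZ /= IH1 IH2 tensPl.
elim/malg_lin_ind: y => [|c y1 y2 IH1 IH2|b].
- by rewrite tens0r !linear0 tens0r.
- by rewrite tensPr !linear_PZ /= IH1 IH2 tensPr.
by rewrite tensU tmapU.
Qed.

Lemma eq_tmap (f f' : {malg K[A]} -> {malg K[A']}) (g g' : {malg K[B]} -> {malg K[B']}) :
  f =1 f' -> g =1 g' -> tmap f g =1 tmap f' g'.
Proof. by move=> ef eg z; rewrite tmap.unlock; apply: eq_lext => u; rewrite ef eg. Qed.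

End Tmap.

Lemma tmap_id (A B : choiceType) (z : (malg2 K A B)) : tmap idfun idfun z = z.
Proof.
elim/malg_lin_ind: z => [|c x y|[a b]]; first by rewrite linear0.
  by rewrite linear_PZ /= => -> ->.
by rewrite tmapU /= tensU.
Qed.

Lemma tmap_comp (A B A' B' A2 B2 : choiceType) (f' : {linear {malg K[A']} -> {malg K[A2]}})
    (g' : {linear {malg K[B']} -> {malg K[B2]}})
    (f : {malg K[A]} -> {malg K[A']}) (g : {malg K[B]} -> {malg K[B']}) z :
  tmap f' g' (tmap f g z) = tmap (f' \o f) (g' \o g) z.
Proof.
elim/malg_lin_ind: z => [|c x y|[a b]]; first by rewrite !linear0.
  by rewrite !linear_PZ /= => -> ->.
by rewrite !tmapU tmap_tens.
Qed.

Lemma tmapZl (A B A' B' : choiceType) c (f f' : {malg K[A]} -> {malg K[A']})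
    (g : {malg K[B]} -> {malg K[B']}) z :
  (forall x, f' x = c *: f x) -> tmap f' g z = c *: tmap f g z.
Proof.
move=> ef; elim/malg_lin_ind: z => [|e x y|[a b]].
- by rewrite !linear0.
- by rewrite !linear_PZ /= => -> ->.
by rewrite !tmapU ef tensZl.
Qed.

Lemma tmapZr (A B A' B' : choiceType) c (f : {malg K[A]} -> {malg K[A']})
    (g g' : {malg K[B]} -> {malg K[B']}) z :
  (forall x, g' x = c *: g x) -> tmap f g' z = c *: tmap f g z.
Proof.
move=> eg; elim/malg_lin_ind: z => [|e x y|[a b]].
- by rewrite !linear0.
- by rewrite !linear_PZ /= => -> ->.
by rewrite !tmapU eg tensZr.
Qed.

End Tensor.

Section MoreTensor.
Variable K : fieldType.

Lemma eq_in_lext (A : choiceType) (V : lmodType K) (f g : A -> V) (x : {malg K[A]}) :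
  (forall a, x@_a != 0 -> f a = g a) -> lext f x = lext g x.
Proof.
move=> eqfg; rewrite lext.unlock; apply: eq_bigr => a _.
by have [->|/eqfg->//] := eqVneq x@_a 0; rewrite !scale0r.
Qed.

Lemma eq_in_tmap (A B A' B' : choiceType) (f f' : {malg K[A]} -> {malg K[A']})
    (g g' : {malg K[B]} -> {malg K[B']}) (z : malg2 K A B) :
  (forall a b, z@_(a, b) != 0 -> f << a >> = f' << a >> /\ g << b >> = g' << b >>) ->
  tmap f g z = tmap f' g' z.
Proof.
move=> e; rewrite tmap.unlock; apply: eq_in_lext => -[a b] /e[/= -> ->] //.
Qed.

Lemma tmap_sum (A B A' B' : choiceType) I J (r : seq I) (s : seq J)
    (f : I -> {malg K[A]} -> {malg K[A']}) (g : J -> {malg K[B]} -> {malg K[B']})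
    (z : malg2 K A B) :
  tmap (fun x => \sum_(i <- r) f i x) (fun y => \sum_(j <- s) g j y) z =
  \sum_(i <- r) \sum_(j <- s) tmap (f i) (g j) z.
Proof.
elim/malg_lin_ind: z => [|e x y|[a b]].
- by rewrite linear0 big1 // => i _; rewrite big1 // => j _; rewrite linear0.
- rewrite !linear_PZ /= => -> ->; rewrite scaler_sumr -big_split; apply: eq_bigr => i _.
  by rewrite scaler_sumr -big_split; apply: eq_bigr => j _ /=; rewrite linear_PZ.
rewrite tmapU tens_suml; apply: eq_bigr => i _; rewrite tens_sumr.
by apply: eq_bigr => j _; rewrite tmapU.
Qed.

Lemma tmapZ (A B A' B' : choiceType) c e (f : {malg K[A]} -> {malg K[A']})
    (g : {malg K[B]} -> {malg K[B']}) (z : malg2 K A B) :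
  tmap (fun x => c *: f x) (fun y => e *: g y) z = (c * e) *: tmap f g z.
Proof.
elim/malg_lin_ind: z => [|h x y|[a b]]; first by rewrite !linear0.
  by rewrite !linear_PZ /= => -> ->.
by rewrite !tmapU tensZl tensZr scalerA.
Qed.

(** This is the identity tensored with the coordinate functional of [b]. Slices turn identities
    between tensors into identities between coefficients. *)
Definition sliceR (A B : choiceType) (b : B) : malg2 K A B -> {malg K[A]} :=
  lext (fun u => if u.2 == b then << u.1 >> else 0).

Definition sliceL (A B : choiceType) (a : A) : malg2 K A B -> {malg K[B]} :=
  lext (fun u => if u.1 == a then << u.2 >> else 0).

HB.instance Definition _ (A B : choiceType) (b : B) := GRing.Linear.on (@sliceR A B b).
HB.instance Definition _ (A B : choiceType) (a : A) := GRing.Linear.on (@sliceL A B a).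

Lemma sliceRE (A B : choiceType) (b : B) (z : malg2 K A B) a :
  (sliceR b z)@_a = z@_(a, b).
Proof.
elim/malg_lin_ind: z => [|e x y|[a' b']]; first by rewrite linear0 !mcoeff0.
  by rewrite linear_PZ !mcoeffD !mcoeffZ => -> ->.
rewrite /sliceR lextU mcoeffU xpair_eqE /=; case: (b' == b); last by rewrite mcoeff0 andbF.
by rewrite mcoeffU andbT.
Qed.

Lemma sliceLE (A B : choiceType) (a : A) (z : malg2 K A B) b :
  (sliceL a z)@_b = z@_(a, b).
Proof.
elim/malg_lin_ind: z => [|e x y|[a' b']]; first by rewrite linear0 !mcoeff0.
  by rewrite linear_PZ !mcoeffD !mcoeffZ => -> ->.
rewrite /sliceL lextU mcoeffU xpair_eqE /=; case: (a' == a); last by rewrite mcoeff0.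
by rewrite mcoeffU.
Qed.

Lemma tmapEl (A B A' : choiceType) (f : {linear {malg K[A]} -> {malg K[A']}})
    (z : malg2 K A B) a b :
  (tmap f idfun z)@_(a, b) = (f (sliceR b z))@_a.
Proof.
elim/malg_lin_ind: z => [|e x y|[a' b']]; first by rewrite !linear0 ?mcoeff0.
  by rewrite !linear_PZ !mcoeffD !mcoeffZ => -> ->.
rewrite tmapU tensE /sliceR lextU mcoeffU /=; case: (b' == b); first by rewrite mulr1.
by rewrite mulr0 linear0 mcoeff0.
Qed.

Lemma tmapEr (A B B' : choiceType) (f : {linear {malg K[B]} -> {malg K[B']}})
    (z : malg2 K A B) a b :
  (tmap idfun f z)@_(a, b) = (f (sliceL a z))@_b.
Proof.
elim/malg_lin_ind: z => [|e x y|[a' b']]; first by rewrite !linear0 ?mcoeff0.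
  by rewrite !linear_PZ !mcoeffD !mcoeffZ => -> ->.
rewrite tmapU tensE /sliceL lextU mcoeffU /=; case: (a' == a); first by rewrite mul1r.
by rewrite mul0r linear0 mcoeff0.
Qed.

End MoreTensor.

Section IterLinear.
Variables (K : fieldType) (U : lmodType K) (f : {linear U -> U}).

Lemma iter_is_linear n : linear (iter n f).
Proof. by elim: n => [|n IH] c x y //=; rewrite IH linear_PZ. Qed.

HB.instance Definition _ n := GRing.isLinear.Build K U U _ (iter n f) (iter_is_linear n).

End IterLinear.

(** Diagonal summation of a Cauchy product: pairs are grouped by j + l = i, and those outside the
    triangle contribute nothing. *)
Lemma sum_triangle (V : nmodType) n (f : nat -> nat -> V) :
  (forall j l, (n <= j + l)%N -> f j l = 0) ->
  \sum_(i < n) \sum_(j < i.+1) f j (i - j)%N = \sum_(j < n) \sum_(l < n) f j l.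
Proof.
move=> f0; transitivity (\sum_(i < n) \sum_(j < n | (j <= i)%N) f j (i - j)%N).
  apply: eq_bigr => i _; rewrite (big_ord_widen n (fun j => f j (i - j)%N) (ltn_ord i)).
  exact: eq_bigl.
rewrite (exchange_big_dep predT) //=; apply: eq_bigr => j _.
rewrite -(big_mkord (fun i => j <= i)%N (fun i => f j (i - j)%N)).
rewrite -(big_mkord predT (fun l => f j l)) (big_cat_nat (n := j)) //=; last exact: ltnW.
rewrite big_nat_cond big1 ?add0r; last first.
  by move=> i /andP[/andP[_ lij]]; rewrite leqNgt lij.
rewrite [RHS](big_cat_nat (n := (n - j)%N)) ?leq_subr //=.
rewrite [X in _ = _ + X]big_nat_cond [X in _ = _ + X]big1 ?addr0; last first.
  by move=> l /andP[/andP[l1 _] _]; rewrite f0 // -leq_subLR.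
rewrite -{1}[val j]add0n big_addn; apply: congr_big_nat => // i.
  by rewrite leq_addl.
by rewrite addnK.
Qed.

(** * The coalgebra U = S(W0) *)

Section DividedPowers.
Variables (K : fieldType) (p : nat).
Local Notation M := {ffun 'I_p -> nat}.
Local Notation U := {malg K[M]}.
Local Notation U2 := (malg2 K M M).
Implicit Types (a b c : M) (x y : U).

Definition madd a b : M := [ffun i => (a i + b i)%N].
Definition wdeg a : nat := (\sum_i a i)%N.
Definition mX (k : 'I_p) : M := [ffun j => nat_of_bool (j == k)].
Definition m0 : M := [ffun=> 0%N].

Lemma maddC : commutative madd.
Proof. by move=> a b; apply/ffunP => i; rewrite !ffunE addnC. Qed.

Lemma maddA : associative madd.
Proof. by move=> a b c; apply/ffunP => i; rewrite !ffunE addnA. Qed.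

Lemma madd0 a : madd a m0 = a.
Proof. by apply/ffunP => i; rewrite !ffunE addn0. Qed.

Lemma madd0m a : madd m0 a = a.
Proof. by rewrite maddC madd0. Qed.

Lemma wdegD a b : wdeg (madd a b) = (wdeg a + wdeg b)%N.
Proof. by rewrite /wdeg -big_split; apply: eq_bigr => i _; rewrite ffunE. Qed.

Lemma wdeg0 : wdeg m0 = 0%N.
Proof. by rewrite /wdeg big1 // => i _; rewrite ffunE. Qed.

Lemma wdegX k : wdeg (mX k) = 1%N.
Proof.
rewrite /wdeg (bigD1 k) //= big1 ?ffunE ?eqxx // => i /negPf ik.
by rewrite ffunE ik.
Qed.

Lemma wdeg_eq0 a : wdeg a = 0%N -> a = m0.
Proof.
move=> /eqP; rewrite /wdeg sum_nat_eq0 => /forallP h; apply/ffunP => i.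
by rewrite ffunE; apply/eqP/h.
Qed.

Lemma wdeg_split a : (0 < wdeg a)%N -> exists k b, a = madd b (mX k).
Proof.
rewrite /wdeg lt0n sum_nat_eq0 => /forallPn[k]; rewrite /= => ak.
exists k, [ffun i => (a i - (i == k))%N]; apply/ffunP => i; rewrite !ffunE.
by rewrite subnK //; case: eqP => // ->; rewrite lt0n.
Qed.

(** The degree filtration of U. The inequality is strict so that [below 0] contains only 0, from
    which inductions on [n] start. *)
Definition below n x := forall a, x@_a != 0 -> (wdeg a < n)%N.

Lemma below_exists x : exists n, below n x.
Proof.
exists (\max_(a <- msupp x) wdeg a).+1 => a xa; rewrite ltnS.
by apply: (leq_bigmax_seq (F := wdeg)) => //; rewrite -mcoeff_neq0.
Qed.

Lemma below_le m n x : (m <= n)%N -> below m x -> below n x.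
Proof. by move=> lmn h a /h /leq_trans; apply. Qed.

Lemma below0 n : below n 0.
Proof. by move=> a; rewrite mcoeff0 eqxx. Qed.

Lemma below_0 x : below 0 x -> x = 0.
Proof.
move=> h; apply/malgP => a; rewrite mcoeff0; apply/eqP/negPn/negP => /h.
by rewrite ltn0.
Qed.

Lemma belowP n x : below n x <-> forall a, (n <= wdeg a)%N -> x@_a = 0.
Proof.
split=> h a.
  by move=> na; apply/eqP/negPn/negP => /h; rewrite ltnNge na.
by move=> /eqP xa; rewrite ltnNge; apply/negP => /h.
Qed.

Lemma belowPZ n e x y : below n x -> below n y -> below n (e *: x + y).
Proof.
move=> /belowP hx /belowP hy; apply/belowP => a na.
by rewrite mcoeffD mcoeffZ hx // hy // mulr0 addr0.
Qed.

Lemma belowD n x y : below n x -> below n y -> below n (x + y).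
Proof. by rewrite -[x in x + y]scale1r; apply: belowPZ. Qed.

Lemma belowZ n e x : below n x -> below n (e *: x).
Proof. by move=> h; rewrite -[_ *: _]addr0; apply: belowPZ (below0 _). Qed.

Lemma belowN n x : below n x -> below n (- x).
Proof. by rewrite -scaleN1r; apply: belowZ. Qed.

Lemma below_sum n I (r : seq I) (P : pred I) (F : I -> U) :
  (forall i, P i -> below n (F i)) -> below n (\sum_(i <- r | P i) F i).
Proof. by move=> h; apply: big_ind => //; [apply: below0|apply: belowD]. Qed.

Lemma belowU n a : (wdeg a < n)%N -> below n << a >>.
Proof. by move=> an b; rewrite mcoeffU; case: (eqVneq a b) => [<-//|]; rewrite eqxx. Qed.

(* [<< a >>] stands for the divided power e^a / a!, so that the coproduct of
   U = S(W0) is [<< a >> |-> \sum_(b + c = a) << b >> (x) << c >>]. *)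
Definition comul : U -> U2 := lext (fun a =>
  \sum_(b : {dffun forall i : 'I_p, 'I_(a i).+1})
     << ([ffun i => nat_of_ord (b i)] : M, [ffun i => (a i - b i)%N] : M) >>).

HB.instance Definition _ := GRing.Linear.on comul.

(** In divided powers no binomial coefficients occur: the coproduct is dual to the multiplication of
    monomials. *)
Lemma comulE x b c : (comul x)@_(b, c) = x@_(madd b c).
Proof.
elim/malg_lin_ind: x => [|e x y|a]; first by rewrite linear0 !mcoeff0.
  by rewrite linear_PZ !mcoeffD !mcoeffZ => -> ->.
rewrite /comul lextU mcoeffU raddf_sum /=.
have [->|neq] := eqVneq a (madd b c); last first.
  rewrite big1 // => d _; rewrite mcoeffU xpair_eqE.
  case: eqP => //= eb; case: eqP => //= ec; case/negP: neq; apply/eqP/ffunP => i.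
  by rewrite ffunE -eb -ec !ffunE subnKC // -ltnS ltn_ord.
(* The splitting [d] of b + c into b and c selects the single nonzero term of the sum. *)
pose d : {dffun forall i : 'I_p, 'I_(madd b c i).+1} := [ffun i => inord (b i)].
have dE i : d i = b i :> nat by rewrite [d i]ffunE inordK // ltnS [madd b c i]ffunE leq_addr.
move: d dE => d dE; rewrite (bigD1 d) //= big1 ?addr0 => [|d' nd].
  rewrite mcoeffU; case: eqP => // -[]; congr pair; apply/ffunP => i.
    by rewrite ffunE dE.
  by rewrite ffunE dE [madd b c i]ffunE addKn.
rewrite mcoeffU xpair_eqE; case: eqP => //= e; case/negP: nd; apply/eqP/ffunP => i.
by apply/val_inj; rewrite /= dE -[in RHS]e [in RHS]ffunE.
Qed.

(** On divided powers this is the iterated partial derivative with multi-index [c]. *)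
Definition shift c x : U := sliceR c (comul x).

HB.instance Definition _ c := GRing.Linear.copy (shift c) (sliceR c \o comul).

Lemma shiftE c x b : (shift c x)@_b = x@_(madd b c).
Proof. by rewrite sliceRE comulE. Qed.

Lemma sliceL_comul b x : sliceL b (comul x) = shift b x.
Proof. by apply/malgP => c; rewrite sliceLE comulE shiftE maddC. Qed.

Lemma shift0 x : shift m0 x = x.
Proof. by apply/malgP => b; rewrite shiftE madd0. Qed.

Lemma below_shift n c x : below n x -> below (n - wdeg c) (shift c x).
Proof.
move=> /belowP h; apply/belowP => b; rewrite leq_subLR => nb.
by rewrite shiftE h // wdegD addnC.
Qed.

(** Dually, on formal power series, a [coder] is a derivation, a [contr] is multiplication by a
    series, and a [coalg] is a multiplicative map. *)
Definition coder (V : U -> U) :=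
  forall x, comul (V x) = tmap V idfun (comul x) + tmap idfun V (comul x).
Definition contr (H : U -> U) := forall x, comul (H x) = tmap H idfun (comul x).
Definition coalg (P : U -> U) := forall x, comul (P x) = tmap P P (comul x).

Lemma coderP (V : {linear U -> U}) :
  coder V <-> forall x b c, (V x)@_(madd b c) = (V (shift c x))@_b + (V (shift b x))@_c.
Proof.
split=> h x.
  by move=> b c; rewrite -comulE h mcoeffD tmapEl tmapEr sliceL_comul.
by apply: malg2P => b c; rewrite comulE h mcoeffD tmapEl tmapEr sliceL_comul.
Qed.

Lemma contrP (H : {linear U -> U}) :
  contr H <-> forall x b c, (H x)@_(madd b c) = (H (shift c x))@_b.
Proof.
split=> h x; first by move=> b c; rewrite -comulE h tmapEl.
by apply: malg2P => b c; rewrite comulE h tmapEl.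
Qed.

(** The coproduct is cocommutative, so a contraction may act on either tensor factor. *)
Lemma contr_r (H : {linear U -> U}) x : contr H -> comul (H x) = tmap idfun H (comul x).
Proof.
move=> /contrP h; apply: malg2P => b c.
by rewrite comulE tmapEr sliceL_comul -h maddC.
Qed.

(** The operators V (x) 1 and 1 (x) V commute, whence the binomial formula for the powers of their
    sum. *)
Lemma coder_iter (V : {linear U -> U}) n x : coder V ->
  comul (iter n V x) =
  \sum_(j < n.+1) 'C(n, j)%:R *: tmap (iter j V) (iter (n - j) V) (comul x).
Proof.
move=> cV; elim: n => [|n IH] /=.
  by rewrite big_ord1 bin0 scale1r /= tmap_id.
rewrite cV IH !linear_sum /=.
have E1 j : tmap V idfun ('C(n, j)%:R *: tmap (iter j V) (iter (n - j) V) (comul x)) =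
    'C(n, j)%:R *: tmap (iter j.+1 V) (iter (n - j) V) (comul x).
  by rewrite linearZ /= tmap_comp.
have E2 j : (j <= n)%N ->
    tmap idfun V ('C(n, j)%:R *: tmap (iter j V) (iter (n - j) V) (comul x)) =
    'C(n, j)%:R *: tmap (iter j V) (iter (n.+1 - j) V) (comul x).
  by move=> jn; rewrite linearZ /= tmap_comp subSn.
rewrite [RHS]big_ord_recl bin0 [in RHS]subn0.
under [X in X + _]eq_bigr => j _ do rewrite E1.
under [X in _ + X]eq_bigr => j _ do rewrite E2 ?leq_ord //.
rewrite [X in _ + X]big_ord_recl bin0 addrCA; congr (_ + _).
(* Pascal's rule splits the right-hand side into the two sums that come from V on the left and on
   the right factor. *)
under [RHS]eq_bigr => j _ do rewrite binS natrD scalerDl subSS.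
rewrite big_split addrC; congr (_ + _).
by rewrite [RHS]big_ord_recr /= bin_small // scale0r addr0.
Qed.

(** As a contraction may act on either factor, the [i + j] copies can be distributed at will. *)
Lemma contr_iter (H : {linear U -> U}) i j x : contr H ->
  comul (iter (i + j) H x) = tmap (iter i H) (iter j H) (comul x).
Proof.
move=> cH; elim: i => [|i IH].
  elim: j => [|j IH]; first by rewrite tmap_id.
  by rewrite /= contr_r // IH tmap_comp.
by rewrite addSn /= cH IH tmap_comp.
Qed.

End DividedPowers.

Arguments m0 {p}.

(** * Normal ordered sums *)

Section NormalOrdered.
Variables (K : fieldType) (p : nat).
Hypothesis char0 : [pchar K] =i pred0.
Local Notation M := {ffun 'I_p -> nat}.
Local Notation U := {malg K[M]}.
Implicit Types (a b c : M) (x y : U).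

Lemma natr_neq0 n : n.+1%:R != 0 :> K.
Proof. by rewrite (proj1 (pcharf0P K) char0). Qed.

Lemma invfactS n : (n.+1`!%:R)^-1 * n.+1%:R = (n`!%:R)^-1 :> K.
Proof. by rewrite factS natrM invfM mulrAC mulVf ?mul1r // natr_neq0. Qed.

Definition lowers (H : U -> U) := forall n x, below n x -> below n.-1 (H x).
Definition raises (T : U -> U) := forall n x, below n x -> below n.+1 (T x).

Lemma below_iter_lowers H n i x : lowers H -> below n x -> below (n - i) (iter i H x).
Proof.
by move=> lH bx; elim: i => [|i IH]; rewrite ?subn0 //= subnS; apply: lH.
Qed.

Lemma iter_lowers_eq0 H n i x : lowers H -> below n x -> (n <= i)%N -> iter i H x = 0.
Proof.
by move=> lH /(below_iter_lowers (i := i) lH) + /eqnP ni; rewrite ni => /below_0.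
Qed.

Lemma below_iter_raises T n i x : raises T -> below n x -> below (n + i) (iter i T x).
Proof.
by move=> rT bx; elim: i => [|i IH]; rewrite ?addn0 //= addnS; apply: rT.
Qed.

(* \sum_i V^i P H^i / i!, cut on << a >> at i = |a|: the remaining terms vanish
   when H lowers degrees. *)
Definition vsum (V P H : U -> U) : U -> U := lext (fun a =>
  \sum_(i < (wdeg a).+1) (i`!%:R)^-1 *: iter i V (P (iter i H << a >>))).

HB.instance Definition _ V P H := GRing.Linear.on (vsum V P H).

(** Beyond the degree of a basis element the powers of [H] vanish on it, so every cutoff that
    exceeds the degree of [x] gives the same sum. *)
Lemma vsumE (V P H : {linear U -> U}) n x : lowers H -> below n x ->
  vsum V P H x = \sum_(i < n) (i`!%:R)^-1 *: iter i V (P (iter i H x)).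
Proof.
move=> lH bx.
transitivity (lext (fun a => \sum_(i < n)
    (i`!%:R)^-1 *: (iter i V \o (P \o iter i H)) << a >>) x); last first.
  elim/malg_lin_ind: {bx} x => [|e x y|a]; last by rewrite lextU.
    rewrite linear0 big1 // => i _.
    by rewrite !linear0.
  rewrite linear_PZ /= => -> ->; rewrite scaler_sumr -big_split; apply: eq_bigr => i _.
  by rewrite !linear_PZ.
apply: eq_in_lext => a /bx lan.
rewrite (big_ord_widen n (fun i => (i`!%:R)^-1 *: iter i V (P (iter i H << a >>))) lan).
rewrite big_mkcond; apply: eq_bigr => i _; case: ltnP => //= lai.
by rewrite (iter_lowers_eq0 lH (belowU (ltnSn (wdeg a))) lai) !linear0.
Qed.

(** Under the coproduct, V^i spreads by the binomial formula and H^i splits as H^j (x) H^(i-j). As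
    C(i, j) / i! = 1 / (j! (i-j)!), the result is the tensor product of two copies of the sum. *)
Lemma vsum_coalg (V P H : {linear U -> U}) :
  coder V -> coalg P -> contr H -> lowers H -> coalg (vsum V P H).
Proof.
move=> cV cP cH lH x; have [n bx] := below_exists x.
pose F i := (fun y => (i`!%:R)^-1 *: iter i V (P (iter i H y))).
transitivity (tmap (fun y => \sum_(i < n) F i y) (fun y => \sum_(i < n) F i y) (comul x));
  last first.
  (* A pair (a, b) that occurs in the coproduct of [x] has |a| + |b| < n, so [n] is a valid cutoff
     in both factors. *)
  apply: eq_in_tmap => a b; rewrite comulE => /bx; rewrite wdegD => lab.
  by split; rewrite (@vsumE _ _ _ n) //; apply: belowU; apply: leq_ltn_trans lab;
     rewrite ?leq_addr ?leq_addl.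
rewrite tmap_sum (vsumE _ _ lH bx) linear_sum.
pose f j l := (j`!%:R^-1 * l`!%:R^-1) *:
  tmap (iter j V \o (P \o iter j H)) (iter l V \o (P \o iter l H)) (comul x).
transitivity (\sum_(j < n) \sum_(l < n) f j l); last first.
  by apply: eq_bigr => j _; apply: eq_bigr => l _; rewrite /F tmapZ.
(* For n <= j + l the term contains H^(j+l) x = 0. *)
rewrite -sum_triangle => [|j l njl]; last first.
  rewrite /f -tmap_comp -[X in tmap _ _ X]tmap_comp -contr_iter //.
  by rewrite (iter_lowers_eq0 lH bx njl) !linear0.
apply: eq_bigr => i _; rewrite linearZ /= coder_iter // scaler_sumr.
apply: eq_bigr => j _; have lji : (j <= i)%N by rewrite -ltnS.
rewrite scalerA cP.
have -> : comul (iter i H x) = tmap (iter j H) (iter (i - j) H) (comul x).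
  by rewrite -contr_iter // subnKC.
rewrite !tmap_comp /f.
have E : i`!%:R^-1 * 'C(i, j)%:R = j`!%:R^-1 * (i - j)`!%:R^-1 :> K.
  have C0 : 'C(i, j)%:R != 0 :> K by rewrite (proj1 (pcharf0P K) char0) -lt0n bin_gt0.
  have -> : i`!%:R = 'C(i, j)%:R * (j`!%:R * (i - j)`!%:R) :> K.
    by rewrite -!natrM bin_fact.
  by rewrite invfM mulrAC mulVf // mul1r invfM.
by rewrite E.
Qed.

(** Here and in [comm_iter] the scalar [e] lets [T] and [-T] be treated alike; at [i = 0] the
    coefficient vanishes, so the default value of [i.-1] is harmless. *)
Lemma iter_comm (A T : {linear U -> U}) (e : K) :
  (forall x, A (T x) = T (A x) + e *: x) ->
  forall i x, iter i A (T x) = T (iter i A x) + (i%:R * e) *: iter i.-1 A x.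
Proof.
move=> h; elim=> [|i IH] x; first by rewrite mul0r scale0r addr0.
rewrite iterS IH linearD h linearZ /= -addrA; congr (_ + _).
case: i {IH} => [|i]; first by rewrite mul0r scale0r addr0 mul1r.
have -> : i.+2%:R * e = e + i.+1%:R * e by rewrite -natr1 mulrDl mul1r addrC.
by rewrite scalerDl.
Qed.

Lemma comm_iter (A T : {linear U -> U}) (e : K) :
  (forall x, A (T x) = T (A x) + e *: x) ->
  forall i x, A (iter i T x) = iter i T (A x) + (i%:R * e) *: iter i.-1 T x.
Proof.
move=> h; elim=> [|i IH] x; first by rewrite mul0r scale0r addr0.
rewrite iterS h IH linearD linearZ /= -addrA; congr (_ + _).
case: i {IH} => [|i]; first by rewrite mul0r scale0r add0r mul1r.
have -> : i.+2%:R * e = e + i.+1%:R * e by rewrite -natr1 mulrDl mul1r addrC.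
by rewrite scalerDl addrC.
Qed.

(** * Operators with the relation [A, T] = 1 *)

Section Heisenberg.
Variables (A T : {linear U -> U}).
Hypothesis comm : forall x, A (T x) = T (A x) + x.
Hypotheses (lA : lowers A) (rT : raises T).

Let comm1 x : A (T x) = T (A x) + 1 *: x. Proof. by rewrite scale1r. Qed.

(** In A^i T = T A^i + i A^(i-1) the first term is killed by P; the second, divided by i!, moves the
    index by one and leaves one V over. *)
Lemma vsum_shift (V P : {linear U -> U}) : (forall x, P (T x) = 0) ->
  forall x, vsum V P A (T x) = V (vsum V P A x).
Proof.
move=> PT x; have [n bx] := below_exists x.
rewrite (vsumE _ _ lA bx) (vsumE _ _ lA (rT bx)).
under eq_bigr => i _ do rewrite (iter_comm comm1) linearD PT add0r mulr1.
rewrite big_ord_recl /= scale0r !linear0 add0r linear_sum; apply: eq_bigr => i _ /=.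
by rewrite [RHS]linearZ /= linearZ /= linearZ /= linearZ /= scalerA invfactS.
Qed.

(** The mirror image: A moves past T^i and dies on the range of P, and in the remaining T^(i-1) P
    H^i one H is applied to [x] first. *)
Lemma shift_vsum (P H : {linear U -> U}) : (forall x, A (P x) = 0) -> lowers H ->
  forall x, A (vsum T P H x) = vsum T P H (H x).
Proof.
move=> AP lH x; have [n bx] := below_exists x.
(* The bound is made a successor, so that [n] itself bounds [H x]. *)
have {}bx : below n.+1 x by apply: below_le bx.
rewrite (vsumE _ _ lH bx) (vsumE _ _ lH (lH _ _ bx)) linear_sum.
under eq_bigr => i _ do rewrite linearZ /= (comm_iter comm1) AP linear0 add0r mulr1.
rewrite big_ord_recl /= scale0r linear0 add0r; apply: eq_bigr => i _ /=.
by rewrite scalerA invfactS -iterSr.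
Qed.

Definition negop x : U := - T x.
HB.instance Definition _ := GRing.Linear.copy negop (-%R \o T).
Local Notation N := negop.

Let commN x : A (N x) = N (A x) + (-1) *: x.
Proof. by rewrite /N linearN comm opprD scaleN1r. Qed.

(* For T multiplication by v and A contraction with l, this is S of the
   projection of W0 along v onto ker l. *)
Definition vproj : U -> U := vsum negop idfun A.
HB.instance Definition _ := GRing.Linear.on vproj.

Lemma vprojE n x : below n x ->
  vproj x = \sum_(i < n) (i`!%:R)^-1 *: iter i N (iter i A x).
Proof. exact: (@vsumE N idfun A n x lA). Qed.

(** Commuting A^i past T gives two sums that differ by a shift of the index and by the sign. *)
Lemma vproj_shift x : vproj (T x) = 0.
Proof.
have [n bx] := below_exists x; rewrite (vprojE (rT bx)).
under eq_bigr => i _ do rewrite (iter_comm comm1) linearD scalerDr mulr1 /=.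
(* The last term of the first sum contains A^n x = 0 and the first term of the second has the factor
   0; the others cancel in pairs. *)
rewrite big_split /= big_ord_recr [X in _ + X]big_ord_recl /= scale0r linear0 add0r.
rewrite (iter_lowers_eq0 lA bx (leqnn n)) !linear0 addr0 -big_split big1 // => i _.
have NT k y : iter k.+1 N y = - iter k N (T y) by rewrite iterSr -[N y]/(- T y) linearN.
change (i`!%:R^-1 *: iter i N (T (iter i A x)) +
  (i.+1`!%:R)^-1 *: iter i.+1 N (i.+1%:R *: iter i A x) = 0).
rewrite [iter i.+1 N (_ *: _)]NT linearZ linearZ /= scalerN scalerA invfactS.
exact: subrr.
Qed.

Lemma shift_vproj x : A (vproj x) = 0.
Proof.
have [n bx] := below_exists x.
have {}bx : below n.+1 x by apply: below_le bx.
rewrite (vprojE bx) linear_sum /=.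
under eq_bigr => i _ do rewrite linearZ /= (comm_iter commN) scalerDr -iterS.
rewrite big_split /= big_ord_recr [X in _ + X]big_ord_recl /= mul0r scale0r linear0 add0r.
rewrite -[A (iter n A x)]iterS (iter_lowers_eq0 lA bx (leqnn n.+1)) !linear0 addr0 -big_split big1 // => i _ /=.
by rewrite scalerA mulrA invfactS mulrN1 scaleNr addrN.
Qed.

Lemma vproj_ker x : A x = 0 -> vproj x = x.
Proof.
move=> Ax; have [n bx] := below_exists x.
have {}bx : below n.+1 x by apply: below_le bx.
rewrite (vprojE bx) big_ord_recl /= fact0 invr1 scale1r big1 ?addr0 // => i _.
by rewrite -[A (iter _ A x)]iterS iterSr Ax !linear0.
Qed.

Lemma vproj_idem x : vproj (vproj x) = vproj x.
Proof. by rewrite vproj_ker // shift_vproj. Qed.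

(** This is Taylor expansion along [v]. *)
Lemma vsum_vproj x : vsum T vproj A x = x.
Proof.
have [n] := below_exists x; elim: n x => [|n IH] x bx.
  by rewrite (below_0 bx) linear0.
(* By induction applied to [A x], the difference of the two sides lies in the kernel of A and is
   therefore fixed by [vproj]. But [vproj] kills its terms with i > 0 and takes the rest to
   [vproj x - vproj x]. *)
apply/eqP; rewrite -subr_eq0; apply/eqP; rewrite -[LHS]vproj_ker.
  rewrite linearB /= (vsumE _ _ lA bx) big_ord_recl linearD /= fact0 invr1 scale1r.
  rewrite vproj_idem linear_sum big1 ?addr0 ?subrr // => i _.
  by rewrite linearZ /= vproj_shift scaler0.
by rewrite linearB /= (shift_vsum shift_vproj lA) (IH _ (lA bx)) subrr.
Qed.

Lemma below_vproj n x : below n x -> below n (vproj x).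
Proof.
move=> bx; rewrite (vprojE bx); apply: below_sum => i _; apply: belowZ.
rewrite -[X in below X _](subnK (ltnW (ltn_ord i))).
apply: below_iter_raises; last exact: below_iter_lowers.
by move=> m y by_; apply/belowN/rT.
Qed.

Lemma vproj_coalg : coder T -> contr A -> coalg vproj.
Proof.
move=> cT cA; apply: (@vsum_coalg N idfun A) => // [x|x]; last by rewrite /= tmap_id.
have NT y : N y = (-1) *: T y by rewrite scaleN1r.
by rewrite /= NT linearZ /= cT scalerDr -(tmapZl _ _ NT) -(tmapZr _ _ NT).
Qed.

(** By [vsum_vproj] the identity is the same sum with T in place of V. Each V^i - T^i raises degrees
    by at most i - 1, while A^i lowers them by at least i. *)
Lemma vsum_unipotentl (V : {linear U -> U}) n x :
  (forall n x, below n x -> below n (V x - T x)) ->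
  below n.+1 x -> below n (vsum V vproj A x - x).
Proof.
move=> VT bx; rewrite -{2}[x]vsum_vproj !(vsumE _ _ lA bx) -sumrB.
have rV : raises V.
  move=> m y by_; rewrite -[V y](subrK (T y)); apply: belowD; last exact: rT.
  by apply: below_le (VT _ _ by_).
have VTi i m y : below m.+1 y -> below (m + i) (iter i V y - iter i T y).
  move=> by_; elim: i => [|i IH] /=; first by rewrite subrr; apply: below0.
  (* V^(i+1) - T^(i+1) = V (V^i - T^i) + (V - T) T^i. *)
  rewrite -[X in below _ (X - _)](subrK (V (iter i T y))) -addrA -linearB.
  apply: belowD; first by rewrite addnS; apply: rV.
  by apply: VT; rewrite addnS -addSn; apply: below_iter_raises.
apply: below_sum => i _; rewrite -scalerBr; apply: belowZ.
have li : (i <= n)%N by rewrite -ltnS.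
rewrite -[X in below X _](subnK li); apply: VTi; apply: below_vproj.
by rewrite -subSn //; apply: below_iter_lowers.
Qed.

(** As H - A lowers degrees by two, H^i - A^i lowers them by at least i + 1, one more than T^i gives
    back. *)
Lemma vsum_unipotentr (H : {linear U -> U}) n x : lowers H ->
  (forall n x, below n x -> below (n - 2) (H x - A x)) ->
  below n.+1 x -> below n (vsum T vproj H x - x).
Proof.
move=> lH HA bx; rewrite -{2}[x]vsum_vproj (vsumE _ _ lA bx) (vsumE _ _ lH bx) -sumrB.
have HAi i : below (n.+1 - i - 1) (iter i H x - iter i A x).
  elim: i => [|i IH] /=; first by rewrite subrr; apply: below0.
  rewrite -[X in below _ (X - _)](subrK (H (iter i A x))) -addrA -linearB.
  apply: belowD.
    rewrite (_ : n.+1 - i.+1 - 1 = (n.+1 - i - 1).-1)%N; first exact: lH IH.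
    by rewrite !subn1 subnS.
  by rewrite -subnDA addSn -addnS subnDA; apply: HA; apply: below_iter_lowers.
apply: below_sum => i _; rewrite -scalerBr -!linearB /=; apply: belowZ.
have li : (i <= n)%N by rewrite -ltnS.
rewrite -[X in below X _](subnK li); apply: below_iter_raises => //; apply: below_vproj.
by have := HAi i; rewrite subSn // subn1.
Qed.

(** If T x = 0 and A^(n+1) x = 0, applying A^(n+1) to T x gives (n+1) A^n x = 0; descending in n
    reaches x = 0. *)
Lemma shift_inj x : T x = 0 -> x = 0.
Proof.
move=> Tx; have [n bx] := below_exists x.
have := iter_lowers_eq0 lA bx (leqnn n).
elim: n {bx} => // n IH nx; apply: IH.
have := iter_comm comm1 n.+1 x; rewrite Tx linear0 nx linear0 add0r mulr1 => /esym/eqP.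
by rewrite scaler_eq0 (negPf (natr_neq0 n)) => /eqP.
Qed.

Lemma shift_surj x : exists y, A y = x.
Proof.
have [n bx] := below_exists x.
have := iter_lowers_eq0 lA bx (leqnn n).
elim: n x {bx} => [|n IH] x nx; first by exists 0; rewrite linear0 -nx.
(* Since A^(n+1) x = 0, A^(n+1) T x = (n+1) A^n x, so the corrected vector is killed by A^n. *)
have [|y Ay] := IH (x - n.+1%:R^-1 *: A (T x)).
  rewrite linearB linearZ /= -iterSr (iter_comm comm1) nx linear0 add0r mulr1 scalerA.
  by rewrite mulVf ?natr_neq0 // scale1r subrr.
by exists (y + n.+1%:R^-1 *: T x); rewrite linearD linearZ /= Ay subrK.
Qed.

End Heisenberg.

(** G - 1 lowers the filtration, so injectivity and surjectivity follow by induction on the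
    degree. *)
Lemma unipotent_inverse (G : {linear U -> U}) :
  (forall n x, below n.+1 x -> below n (G x - x)) ->
  exists G' : {linear U -> U}, cancel G G' /\ cancel G' G.
Proof.
move=> uG.
have injG x : G x = 0 -> x = 0.
  move=> Gx; have [n] := below_exists x; elim: n => [/below_0//|n IH /uG].
  by rewrite Gx sub0r => /belowN; rewrite opprK.
have surjG x : exists y, G y == x.
  have [n] := below_exists x; elim: n x => [|n IH] x bx.
    by exists 0; rewrite linear0 (below_0 bx).
  have [y /eqP Gy] := IH _ (uG _ _ bx); exists (x - y).
  by rewrite linearB /= Gy opprB addrC subrK.
(* Preimages are chosen for basis vectors only and extended linearly, which makes the inverse linear
   by construction. *)
pose G' : {linear U -> U} := lext (fun a => xchoose (surjG << a >>)).
have GG' : cancel G' G.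
  move=> x; elim/malg_lin_ind: x => [|e x y|a]; first by rewrite !linear0.
    by rewrite !linear_PZ /= => -> ->.
  by rewrite /G' /= lextU; apply/eqP/(xchooseP (surjG << a >>)).
exists G'; split=> // x; apply/eqP; rewrite -subr_eq0; apply/eqP/injG.
by rewrite linearB GG' subrr.
Qed.

Lemma coalg_inverse (G G' : {linear U -> U}) :
  cancel G G' -> cancel G' G -> coalg G -> coalg G'.
Proof.
move=> GK G'K cG x; rewrite -{2}[x]G'K cG tmap_comp.
rewrite (eq_tmap (f' := idfun) (g' := idfun)) ?tmap_id // => y; exact: GK.
Qed.

End NormalOrdered.

(** * Linear parts and straightening *)

Section LinearParts.
Variables (K : fieldType) (p : nat).
Local Notation M := {ffun 'I_p -> nat}.
Local Notation U := {malg K[M]}.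
Implicit Types (a b c : M) (x y : U) (u v l : 'I_p -> K).

Definition mBX a k : M := [ffun j => (a j - (j == k))%N].

Lemma mBX_add b c k : (0 < b k)%N -> mBX (madd b c) k = madd (mBX b k) c.
Proof.
move=> bk; apply/ffunP => j; rewrite !ffunE.
by case: eqP => [->|_]; rewrite ?subn0 // addnBAC.
Qed.

Lemma mBX_addX b k : mBX (madd b (mX k)) k = b.
Proof. by apply/ffunP => j; rewrite !ffunE; case: (j == k); rewrite ?addn1 ?subn1 ?addn0 ?subn0. Qed.

Lemma madd_mBX b k : (0 < b k)%N -> madd (mBX b k) (mX k) = b.
Proof.
move=> bk; apply/ffunP => j; rewrite !ffunE subnK //.
by case: eqP => // ->.
Qed.

(* Multiplication by \sum_k v_k e_k, in the basis of divided powers. *)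
Definition tv v : U -> U := lext (fun a =>
  \sum_k (v k * (a k).+1%:R) *: << madd a (mX k) >>).
HB.instance Definition _ v := GRing.Linear.on (tv v).

(** Where [b k = 0], no e_k can be removed and [mBX b k] is a mere default, but then the factor
    [b k] kills the term. *)
Lemma tvE v x b : (tv v x)@_b = \sum_k v k * (b k)%:R * x@_(mBX b k).
Proof.
elim/malg_lin_ind: x => [|e x y|a].
- by rewrite linear0 mcoeff0 big1 // => k _; rewrite mcoeff0 mulr0.
- rewrite linear_PZ mcoeffD mcoeffZ => -> ->; rewrite mulr_sumr -big_split.
  by apply: eq_bigr => k _ /=; rewrite mcoeffD mcoeffZ mulrDr mulrCA.
rewrite /tv lextU raddf_sum; apply: eq_bigr => k _ /=; rewrite mcoeffZ !mcoeffU.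
have [<-|nab] := eqVneq (madd a (mX k)) b.
  by rewrite mBX_addX eqxx !ffunE eqxx addn1.
have [eab|_] := eqVneq a (mBX b k); last by rewrite !mulr0.
case: (posnP (b k)) => [->|bk]; first by rewrite !mulr0 mul0r.
by case/eqP: nab; rewrite eab madd_mBX.
Qed.

(** Multiplication by a primitive element is a coderivation; in coefficients this is (b + c)_k = b_k
    + c_k. *)
Lemma tv_coder v : coder (tv v).
Proof.
apply/coderP => x b c; rewrite !tvE -big_split; apply: eq_bigr => k _ /=.
rewrite !shiftE [madd b c k]ffunE natrD mulrDr mulrDl; congr (_ + _).
  by case: (posnP (b k)) => [->|bk]; rewrite ?mulr0 ?mul0r // mBX_add.
by case: (posnP (c k)) => [->|ck]; rewrite ?mulr0 ?mul0r // maddC mBX_add.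
Qed.

Lemma tv_raises v : raises (tv v).
Proof.
move=> n x /belowP bx; apply/belowP => b nb; rewrite tvE big1 // => k _.
case: (posnP (b k)) => [->|bk]; first by rewrite mulr0 mul0r.
move: nb; rewrite -{1}(madd_mBX bk) wdegD wdegX addn1 ltnS => nb.
by rewrite bx ?mulr0.
Qed.

Lemma tv_m0 v x : (tv v x)@_m0 = 0.
Proof. by rewrite tvE big1 // => k _; rewrite ffunE mulr0 mul0r. Qed.

Lemma tv_mX v x k : (tv v x)@_(mX k) = v k * x@_m0.
Proof.
rewrite tvE (bigD1 k) //= big1 ?addr0 => [|j /negPf jk].
  rewrite ffunE eqxx mulr1; congr (_ * _@_ _); apply/ffunP => j.
  by rewrite !ffunE subnn.
by rewrite ffunE jk mulr0 mul0r.
Qed.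

(* Contraction with the linear form e_k |-> l_k. *)
Definition dl l : U -> U := fun x => \sum_k l k *: shift (mX k) x.

Lemma dl_is_linear l : linear (dl l).
Proof.
move=> e x y; rewrite /dl scaler_sumr -big_split; apply: eq_bigr => k _ /=.
by rewrite !linear_PZ.
Qed.
HB.instance Definition _ l := GRing.isLinear.Build K U U _ (dl l) (dl_is_linear l).

Lemma dlE l x b : (dl l x)@_b = \sum_k l k * x@_(madd b (mX k)).
Proof. by rewrite raddf_sum; apply: eq_bigr => k _ /=; rewrite mcoeffZ shiftE. Qed.

Lemma dl_contr l : contr (dl l).
Proof.
apply/contrP => x b c; rewrite !dlE; apply: eq_bigr => k _; rewrite shiftE.
by rewrite -!maddA [madd c _]maddC.
Qed.

Lemma dl_lowers l : lowers (dl l).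
Proof.
move=> n x bx; apply: below_sum => k _; apply: belowZ.
by rewrite -subn1 -(wdegX k); apply: below_shift.
Qed.

Lemma dl_tv l v x : dl l (tv v x) = tv v (dl l x) + (\sum_k l k * v k) *: x.
Proof.
apply/malgP => b; rewrite mcoeffD mcoeffZ dlE tvE.
under eq_bigr => j _ do rewrite tvE mulr_sumr.
under [X in _ = X + _]eq_bigr => k _ do rewrite dlE mulr_sumr.
rewrite [X in _ = X + _]exchange_big mulr_suml -big_split; apply: eq_bigr => j _ /=.
(* The scalar l(v) becomes a double sum with a Kronecker delta, to be matched term by term. *)
rewrite [X in _ = _ + X](_ : _ = \sum_k (k == j)%:R * (l j * v j * x@_b)); last first.
  rewrite (bigD1 j) //= eqxx mul1r big1 ?addr0 // => k /negPf ->.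
  by rewrite mul0r.
rewrite -big_split; apply: eq_bigr => k _ /=; rewrite [madd b (mX j) k]ffunE natrD.
rewrite mulrDr mulrDl mulrDr; congr (_ + _).
  case: (posnP (b k)) => [->|bk]; first by rewrite !(mulr0, mul0r).
  by rewrite mBX_add // mulrCA !mulrA.
rewrite [mX j k]ffunE; case: eqP => [->|_]; last by rewrite !(mulr0, mul0r).
by rewrite mBX_addX mulr1 mul1r mulrA.
Qed.

Lemma below1 x : below 1 x -> x = x@_m0 *: << m0 >>.
Proof.
move=> /belowP h; apply/malgP => a; rewrite mcoeffZ mcoeffU.
have [<-|na] := eqVneq m0 a; first by rewrite mulr1.
rewrite mulr0 h // lt0n; apply: contra na => /eqP/wdeg_eq0 ->; exact: eqxx.
Qed.

Lemma below2 x : below 2 x ->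
  x = x@_m0 *: << m0 >> + \sum_k x@_(mX k) *: << mX k >>.
Proof.
move=> bx; apply/malgP => a; rewrite mcoeffD mcoeffZ mcoeffU raddf_sum /=.
under eq_bigr => k _ do rewrite mcoeffZ mcoeffU.
case: (posnP (wdeg a)) => [/wdeg_eq0->|/wdeg_split[k [b ->]]].
  rewrite eqxx mulr1 big1 ?addr0 // => k _.
  case: eqP => [/(congr1 (@wdeg p))|]; last by rewrite mulr0.
  by rewrite wdegX wdeg0.
have -> : (m0 == madd b (mX k)) = false.
  by apply/eqP => /(congr1 (@wdeg p)); rewrite wdegD wdegX addn1 wdeg0.
rewrite mulr0 add0r; case: (posnP (wdeg b)) => [/wdeg_eq0->|b0].
  rewrite madd0m (bigD1 k) //= eqxx mulr1 big1 ?addr0 // => j /negPf jk.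
  case: eqP => [/ffunP/(_ k)|]; last by rewrite mulr0.
  by rewrite !ffunE eqxx eq_sym jk.
rewrite big1 => [|j _]; last first.
  case: eqP => [/(congr1 (@wdeg p))|]; last by rewrite mulr0.
  by rewrite wdegX wdegD wdegX addn1 => -[] e; rewrite -e in b0.
by move: bx => /belowP ->//; rewrite wdegD wdegX addn1 ltnS.
Qed.

(** The coderivation rule at the constant coefficient reads u = u + u. *)
Lemma coder_m0 (V : {linear U -> U}) : coder V -> (V << m0 >>)@_m0 = 0.
Proof.
move=> /coderP h; have := h << m0 >> m0 m0; rewrite madd0 shift0 => /eqP.
by rewrite -subr_eq0 opprD addNKr oppr_eq0 => /eqP.
Qed.

(** Splitting one e_k off a monomial leaves a coefficient of V on a derivative of [x], which the
    induction covers, and one of V on a constant, which is 0. *)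
Lemma coder_below (V : {linear U -> U}) : coder V -> V << m0 >> = 0 ->
  forall n x, below n x -> below n (V x).
Proof.
move=> /coderP cV V0.
have V1 x : below 1 x -> V x = 0 by move=> /below1 ->; rewrite linearZ /= V0 scaler0.
elim=> [|n IH] x bx; first by rewrite (below_0 bx) linear0; apply: below0.
apply/belowP => a; case: n IH bx => [|n] IH bx na; first by rewrite V1 // mcoeff0.
have [k [b ab]] : exists k b, a = madd b (mX k).
  by apply: wdeg_split; apply: leq_ltn_trans na.
move: na; rewrite ab wdegD wdegX addn1 ltnS => nb; rewrite cV.
have /belowP -> // : below n.+1 (V (shift (mX k) x)).
  by apply: IH; have := below_shift (c := mX k) bx; rewrite wdegX subn1.
rewrite add0r V1 ?mcoeff0 //; apply: below_le (below_shift (c := b) bx).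
by rewrite leq_subLR addn1.
Qed.

(** Dually, this is the value of the vector field at the origin, and [form1] is the linear part of
    the function. *)
Definition vec0 (V : U -> U) k : K := (V << m0 >>)@_(mX k).
Definition form1 (H : U -> U) k : K := (H << mX k >>)@_m0.

(** V 1 is primitive, hence linear, so V and multiplication by [vec0 V] agree on 1. Their difference
    is a coderivation that kills 1, and [coder_below] applies. *)
Lemma coder_leading (V : {linear U -> U}) : coder V ->
  forall n x, below n x ->
  below n (V x - tv (vec0 V) x).
Proof.
move=> cV; set v := vec0 V.
pose D : {linear U -> U} := V \- tv v.
apply: (@coder_below D) => [x|]; last first.
  apply/malgP => a; rewrite mcoeff0 /= mcoeffB; apply/eqP; rewrite subr_eq0; apply/eqP.
  case: (posnP (wdeg a)) => [/wdeg_eq0->|/wdeg_split[k [b ->]]].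
    by rewrite coder_m0 // tv_m0.
  case: (posnP (wdeg b)) => [/wdeg_eq0->|b0].
    by rewrite madd0m tv_mX mcoeffUU mulr1.
  have sh0 c : (0 < wdeg c)%N -> shift c (<< m0 >> : U) = 0.
    move=> c0; apply/malgP => d; rewrite shiftE mcoeffU mcoeff0; case: eqP => // e.
    by move: c0; rewrite -(ltn_add2l (wdeg d)) -wdegD -e wdeg0.
  rewrite (proj1 (coderP _) cV) (proj1 (coderP _) (tv_coder v)).
  by rewrite !sh0 ?wdegX // !linear0 !mcoeff0.
have cV' := proj1 (coderP _) cV; have cT' := proj1 (coderP _) (tv_coder v).
apply: (proj2 (coderP D)) => y b c /=.
by rewrite !mcoeffB cV' cT' opprD addrACA.
Qed.

(** A contraction is determined by its constant coefficients: the one of [H x] at [a] is the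
    constant one of [H (shift a x)]. *)
Lemma contr_below (H : {linear U -> U}) d : contr H ->
  (forall x, below d x -> (H x)@_m0 = 0) ->
  forall n x, below n x -> below (n - d) (H x).
Proof.
move=> /contrP cH H0 n x bx; apply/belowP => a na.
rewrite -[a]madd0m cH H0 //; apply: below_le (below_shift (c := a) bx).
by rewrite leq_subLR addnC -leq_subLR.
Qed.

Lemma contr_lowers (H : {linear U -> U}) : contr H -> H << m0 >> = 0 -> lowers H.
Proof.
move=> cH H0 n x; rewrite -subn1; apply: contr_below => // y /below1 ->.
by rewrite linearZ /= H0 scaler0 mcoeff0.
Qed.

(** The difference is a contraction whose constant coefficient vanishes in degrees 0 and 1, so it
    lowers degrees by two. *)
Lemma contr_leading (H : {linear U -> U}) : contr H -> H << m0 >> = 0 ->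
  forall n x, below n x ->
  below (n - 2) (H x - dl (form1 H) x).
Proof.
move=> cH H0; set l := form1 H.
pose D : {linear U -> U} := H \- dl l.
apply: (@contr_below D) => [|x bx].
  have cH' := proj1 (contrP _) cH; have cD' := proj1 (contrP _) (dl_contr l).
  by apply: (proj2 (contrP D)) => y b c /=; rewrite !mcoeffB cH' cD'.
rewrite /= mcoeffB dlE; apply/eqP; rewrite subr_eq0; apply/eqP.
rewrite [x in LHS](below2 bx) [x in RHS](below2 bx).
rewrite linearD linearZ /= H0 scaler0 add0r linear_sum raddf_sum /=.
apply: eq_bigr => k _; rewrite linearZ /= mcoeffZ mcoeffD mcoeffZ raddf_sum /=.
rewrite mcoeffU madd0m (bigD1 k) //= mcoeffZ mcoeffUU mulr1 big1 ?addr0 => [|j /negPf jk].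
  case: eqP => [/(congr1 (@wdeg p))|_]; first by rewrite wdegX wdeg0.
  by rewrite mulr0 add0r mulrC.
rewrite mcoeffZ mcoeffU; case: eqP => [/ffunP/(_ k)|]; last by rewrite mulr0.
by rewrite !ffunE eqxx eq_sym jk.
Qed.

End LinearParts.

(** * Conjugation of V and H to their linear parts *)

Section Straightening.
Variables (K : fieldType) (p : nat).
Hypothesis char0 : [pchar K] =i pred0.
Local Notation M := {ffun 'I_p -> nat}.
Local Notation U := {malg K[M]}.

Lemma dual_vector (v : 'I_p -> K) : (exists k, v k != 0) ->
  exists l : 'I_p -> K, \sum_k l k * v k = 1.
Proof.
case=> k vk; exists (fun j => (v k)^-1 * (j == k)%:R).
rewrite (bigD1 k) //= eqxx mulr1 mulVf // big1 ?addr0 // => j /negPf ->.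
by rewrite mulr0 mul0r.
Qed.

Lemma unipotent_m0 (G : {linear U -> U}) :
  (forall n x, below n.+1 x -> below n (G x - x)) -> G << m0 >> = << m0 >>.
Proof.
move=> uG; apply/eqP; rewrite -subr_eq0; apply/eqP/below_0/uG.
by apply: belowU; rewrite wdeg0.
Qed.

(** V is conjugate to T, which is injective; hence V H = 0 forces H = 0. *)
Lemma straighten_coder (V H : {linear U -> U}) :
  coder V -> (exists k, vec0 V k != 0) -> (forall x, V (H x) = 0) ->
  let T := tv (vec0 V) in
  (forall x, H x = 0) /\
  exists G G' : {linear U -> U}, [/\ cancel G G', cancel G' G, coalg G,
    G << m0 >> = << m0 >> & forall x, V (G x) = G (T x)].
Proof.
move=> cV V0 VH; set v := vec0 V; move=> T; have [l lv] := dual_vector V0.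
have comm x : dl l (T x) = T (dl l x) + x by rewrite dl_tv lv scale1r.
have lA := @dl_lowers K p l; have rT := @tv_raises K p v.
pose G : {linear U -> U} := vsum V (vproj (dl l) (tv v)) (dl l).
have uG n x : below n.+1 x -> below n (G x - x).
  by apply: vsum_unipotentl => //; apply: coder_leading.
have VG x : V (G x) = G (T x).
  by rewrite /G /= vsum_shift // => y; apply: vproj_shift.
have [G' [GK G'K]] := unipotent_inverse uG.
have V_inj x : V x = 0 -> x = 0.
  rewrite -[x]G'K VG => h; rewrite (shift_inj char0 comm lA (x := G' x)) ?linear0 //.
  by rewrite -[LHS]GK h linear0.
split=> [x|]; first exact/V_inj.
exists G, G'; split=> //; last exact: unipotent_m0.
by apply: vsum_coalg => //; [apply: vproj_coalg => //; [apply: tv_coder|]|]; apply: dl_contr.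
Qed.

(** A is surjective, hence so is its conjugate H, and V H = 0 forces V = 0. *)
Lemma straighten_contr (V H : {linear U -> U}) :
  contr H -> H << m0 >> = 0 -> (exists k, form1 H k != 0) ->
  (forall x, V (H x) = 0) ->
  let A := dl (form1 H) in
  (forall x, V x = 0) /\
  exists G G' : {linear U -> U}, [/\ cancel G G', cancel G' G, coalg G,
    G << m0 >> = << m0 >> & forall x, H (G x) = G (A x)].
Proof.
move=> cH H0 Hn0 VH; set l := form1 H; move=> A; have [v vl] := dual_vector Hn0.
have comm x : A (tv v x) = tv v (A x) + x.
  rewrite /A dl_tv; under eq_bigr => k _ do rewrite mulrC.
  by rewrite vl scale1r.
have lA := @dl_lowers K p l; have rT := @tv_raises K p v.
have lH := contr_lowers cH H0.
pose F : {linear U -> U} := vsum (tv v) (vproj (dl l) (tv v)) H.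
have uF n x : below n.+1 x -> below n (F x - x).
  by apply: vsum_unipotentr => //; apply: contr_leading.
have AF x : A (F x) = F (H x).
  by apply: (shift_vsum char0 comm) => // y; apply: shift_vproj.
have [G [FK GK]] := unipotent_inverse uF.
have H_surj x : exists y, H y = x.
  have [y Ay] := shift_surj char0 comm lA (F x); exists (G y).
  by apply: (can_inj FK); rewrite -AF GK.
split=> [x|]; first by have [y <-] := H_surj x.
(* The constructed map satisfies A F = F H, so the map asked for is its inverse [G]. *)
exists G, F; split=> //.
- apply: coalg_inverse FK GK _; apply: vsum_coalg => //; first exact: tv_coder.
  by apply: vproj_coalg => //; [apply: tv_coder|apply: dl_contr].
- by rewrite -{1}(unipotent_m0 uF) FK.
- by move=> x; apply: (can_inj FK); rewrite -AF !GK.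
Qed.

End Straightening.

(** * The super coalgebra S(W) with one odd variable *)

Definition afact (K : fieldType) p (a : {ffun 'I_p -> nat}) : K := (\prod_i (a i)`!)%:R.
Arguments afact {K p}.

(* The part U t_A of S(W): [<< a >>] corresponds to (e^a / a!) t_A. Since S(W)
   is reduced, [inj set0] kills [<< m0 >>]. *)
HB.lock Definition inj (K : fieldType) p (A : {set 'I_1})
    (x : {malg K[{ffun 'I_p -> nat}]}) : {malg K[smon p 1]} :=
  lext (fun a => (afact a)^-1 *: (smonE K (a, A) : {malg K[smon p 1]})) x.

(** Coordinates along [inj A]; the factor a! leads back from e^a to the divided power e^a / a!. *)
HB.lock Definition prj (K : fieldType) p (A : {set 'I_1})
    (y : {malg K[smon p 1]}) : {malg K[{ffun 'I_p -> nat}]} :=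
  lext (fun m : smon p 1 => if (val m).2 == A
    then afact (val m).1 *: << (val m).1 >> else 0) y.

Section OneOddVariable.
Variables (K : fieldType) (p : nat).
Hypothesis char0 : [pchar K] =i pred0.
Local Notation M := {ffun 'I_p -> nat}.
Local Notation U := {malg K[M]}.
Local Notation S := {malg K[smon p 1]}.
Local Notation S2 := (malg2 K (smon p 1) (smon p 1)).
Implicit Types (a b c : M) (A B : {set 'I_1}) (x : U) (y : S).

Lemma set1E A : A = set0 \/ A = setT.
Proof.
case: (set_0Vmem A) => [->|[j jA]]; [by left|right].
by apply/setP => i; rewrite inE (ord1 i) -(ord1 j).
Qed.

Lemma setT1_neq0 : (setT : {set 'I_1}) != set0.
Proof. by apply/set0Pn; exists ord0. Qed.

Lemma afact_neq0 a : afact a != 0 :> K.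
Proof.
rewrite /afact (proj1 (pcharf0P K) char0) -lt0n.
by apply: prodn_gt0 => i; apply: fact_gt0.
Qed.

Lemma afact_m0 : afact (@m0 p) = 1 :> K.
Proof. by rewrite /afact big1 // => i _; rewrite ffunE. Qed.

Lemma afact_mX (k : 'I_p) : afact (mX k) = 1 :> K.
Proof. by rewrite /afact big1 // => i _; rewrite ffunE; case: eqP. Qed.

Lemma inj_is_linear A : linear (@inj K p A).
Proof. by rewrite inj.unlock => c x z; rewrite linear_PZ. Qed.

HB.instance Definition _ A :=
  GRing.isLinear.Build K U S _ (@inj K p A) (inj_is_linear A).

Lemma prj_is_linear A : linear (@prj K p A).
Proof. by rewrite prj.unlock => c x z; rewrite linear_PZ. Qed.

HB.instance Definition _ A :=
  GRing.isLinear.Build K S U _ (@prj K p A) (prj_is_linear A).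

Lemma prjU A (m : smon p 1) : prj A << m >> =
  (if (val m).2 == A then afact (val m).1 *: << (val m).1 >> else 0) :> U.
Proof. by rewrite prj.unlock lextU. Qed.

Lemma injU A a : inj A << a >> = (afact a)^-1 *: (smonE K (a, A) : S).
Proof. by rewrite inj.unlock lextU. Qed.

Lemma smonE_val (m : smon p 1) : smonE K (val m) = << m >>.
Proof. by rewrite /smonE valK. Qed.

Lemma smonE_m0 : smonE K (m0, set0) = 0 :> S.
Proof. by rewrite /smonE insubF //= eqxx. Qed.

Lemma smonE_neq (a : M) A : (a, A) != smon0 p 1 ->
  exists2 m : smon p 1, val m = (a, A) & smonE K (a, A) = << m >> :> S.
Proof. by move=> h; exists (Sub (a, A) h); rewrite ?SubK // -smonE_val SubK. Qed.

Lemma prjE A y a : (prj A y)@_a = afact a * scoef y (a, A).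
Proof.
elim/malg_lin_ind: y => [|e y z IH1 IH2|m].
- by rewrite linear0 /scoef; case: insubP => [m _ _|_]; rewrite /= ?mcoeff0 mulr0.
- rewrite linear_PZ mcoeffD mcoeffZ IH1 IH2 /scoef.
  by case: insubP => [m _ _|_] /=; rewrite ?mcoeffD ?mcoeffZ ?mulrDr ?[e * (_ * _)]mulrCA ?mulr0 ?addr0.
rewrite prjU /scoef; case: insubP => [n _ en|]; rewrite [oapp _ _ _]/=.
  have -> : (<< m >> : S)@_n = 1 *+ (val m == (a, A)) by rewrite -en val_eqE mcoeffU.
  case: (val m) => b B /=; rewrite xpair_eqE.
  case: (B == A); last by rewrite andbF mulr0 /= mcoeff0.
  by rewrite mcoeffZ mcoeffU andbT; case: eqP => [->|]; rewrite ?mulr0.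
move=> /negPn/eqP e; rewrite mulr0; case: eqP => [e2|]; last by rewrite mcoeff0.
rewrite mcoeffZ mcoeffU; case: eqP => [e1|]; last by rewrite mulr0.
case/negP: (valP m); apply/eqP; rewrite -[RHS]e -e1 -e2.
exact: surjective_pairing.
Qed.

Lemma prj_inj_neq A B x : A != B -> prj A (inj B x) = 0.
Proof.
move=> nAB; elim/malg_lin_ind: x => [|e x z|a]; first by rewrite !linear0.
  by rewrite !linear_PZ /= => -> ->; rewrite scaler0 addr0.
rewrite injU linearZ /=; have [e|/smonE_neq[m em ->]] := eqVneq (a, B) (smon0 p 1).
  by rewrite e smonE_m0 linear0 scaler0.
by rewrite prjU em /= eq_sym (negPf nAB) scaler0.
Qed.

Lemma prj_inj_T x : prj setT (inj setT x) = x.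
Proof.
elim/malg_lin_ind: x => [|e x z|a]; first by rewrite !linear0.
  by rewrite !linear_PZ /= => -> ->.
rewrite injU linearZ /=; have [[_ e]|/smonE_neq[m em ->]] := eqVneq (a, setT) (smon0 p 1).
  by have := setT1_neq0; rewrite e eqxx.
by rewrite prjU em /= eqxx scalerA mulVf ?scale1r ?afact_neq0.
Qed.

(** S(W) is reduced, so the passage through it removes the constant term of [x]. *)
Definition pos x : U := prj set0 (inj set0 x).
HB.instance Definition _ := GRing.Linear.copy pos (prj set0 \o inj set0).

Lemma inj_m0 : inj set0 (<< m0 >> : U) = 0.
Proof. by rewrite injU smonE_m0 scaler0. Qed.

Lemma posE x : pos x = x - x@_m0 *: << m0 >>.
Proof.
rewrite /pos; elim/malg_lin_ind: x => [|e x z|a].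
- by rewrite !linear0 mcoeff0 scale0r subr0.
- rewrite !linear_PZ /= => -> ->; rewrite mcoeffD mcoeffZ scalerDl -scalerA opprD addrACA.
  by rewrite scalerBr.
have [->|na] := eqVneq a m0.
  by rewrite inj_m0 linear0 mcoeffUU scale1r subrr.
rewrite mcoeffU (negPf na) scale0r subr0 injU linearZ /=.
have [[e]|/smonE_neq[m em ->]] := eqVneq (a, set0 : {set 'I_1}) (smon0 p 1).
  by rewrite e eqxx in na.
by rewrite prjU em /= eqxx scalerA mulVf ?scale1r ?afact_neq0.
Qed.

Lemma pos_id x : x@_m0 = 0 -> pos x = x.
Proof. by move=> h; rewrite posE h scale0r subr0. Qed.

Lemma pos_coef x a : a != m0 -> (pos x)@_a = x@_a.
Proof.
move=> na; rewrite posE mcoeffB mcoeffZ mcoeffU eq_sym (negPf na) mulr0.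
exact: subr0.
Qed.

Lemma inj_prj y : y = inj set0 (prj set0 y) + inj setT (prj setT y).
Proof.
elim/malg_lin_ind: y => [|e y z IH1 IH2|m]; first by rewrite !linear0 addr0.
  by rewrite {1}IH1 {1}IH2 !linear_PZ /= scalerDr addrACA.
rewrite !prjU.
have im A : (val m).2 = A -> inj A (afact (val m).1 *: << (val m).1 >> : U) = << m >>.
  move=> <-; rewrite linearZ /= injU scalerA mulfV ?afact_neq0 // scale1r.
  by rewrite -surjective_pairing smonE_val.
have [e|e] := set1E (val m).2; rewrite e eqxx.
  by rewrite eq_sym (negPf setT1_neq0) linear0 addr0 im.
by rewrite (negPf setT1_neq0) linear0 add0r im.
Qed.

Lemma stensE (y z : S) : stens y z = tens y z.
Proof.
rewrite tens.unlock lext.unlock /stens; apply: eq_bigr => m _; rewrite scaler_sumr.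
by apply: eq_bigr => n _; rewrite scalerA.
Qed.

(* [scomul] and [stensmap] as linear maps between the [malg] types. *)
Definition scom : S -> S2 := lext (fun m => scomul_mon K m : S2).
HB.instance Definition _ := GRing.Linear.on scom.

Lemma scomulE (y : S) : scomul y = scom y.
Proof. by rewrite /scom lext.unlock. Qed.

Definition smap k (f g : S -> S) : S2 -> S2 := lext (fun u =>
  (-1) ^+ (k && sparity u.1) *: tens (f << u.1 >>) (g << u.2 >>)).
HB.instance Definition _ k f g := GRing.Linear.on (smap k f g).

Lemma stensmapE k (f g : S -> S) (z : S2) : stensmap k f g z = smap k f g z.
Proof.
rewrite /smap lext.unlock /stensmap; apply: eq_bigr => u _.
by rewrite stensE scalerA.
Qed.

Lemma inj_comp (V : lmodType K) (f : {linear S -> V}) A a :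
  (f \o inj A) << a >> = (afact a)^-1 *: f (smonE K (a, A)).
Proof. by rewrite [LHS]/= injU linear_Z; reflexivity. Qed.

Lemma smap_smonE k (f g : {linear S -> S}) a b A B :
  smap k f g (tens (smonE K (a, A) : S) (smonE K (b, B) : S)) =
  (-1) ^+ (k && (A != set0)) *: tens (f (smonE K (a, A))) (g (smonE K (b, B))).
Proof.
have [e|/smonE_neq[m em ->]] := eqVneq (a, A) (smon0 p 1).
  by rewrite e smonE_m0 [f 0]linear0 !tens0l [smap _ _ _ 0]linear0 scaler0.
have [e|/smonE_neq[n en ->]] := eqVneq (b, B) (smon0 p 1).
  by rewrite e smonE_m0 [g 0]linear0 !tens0r [smap _ _ _ 0]linear0 scaler0.
have sp : sparity m = (A != set0).
  rewrite /sparity em; have [->|->] := set1E A; first by rewrite cards0 eqxx.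
  by rewrite cardsT card_ord setT1_neq0.
by rewrite tensU /smap lextU -sp.
Qed.

Lemma scaler3CA (V : lmodType K) (c e s : K) (t : V) :
  c *: (e *: (s *: t)) = s *: (c *: (e *: t)).
Proof. by rewrite !scalerA -[s * c * e]mulrA [s * _]mulrC. Qed.

Lemma smap_inj k (f g : {linear S -> S}) A B (z : malg2 K M M) :
  smap k f g (tmap (inj A) (inj B) z) =
  (-1) ^+ (k && (A != set0)) *: tmap (f \o inj A) (g \o inj B) z.
Proof.
elim/malg_lin_ind: z => [|e z w IHz IHw|[a b]].
- by rewrite !linear0.
- by rewrite !linear_PZ /= IHz IHw.
rewrite [in RHS]tmapU !inj_comp tmapU !injU.
rewrite [in RHS]tensZl [in RHS]tensZr tensZl tensZr.
rewrite [LHS]linear_Z /= [smap _ _ _ _]linear_Z /= smap_smonE.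
exact: scaler3CA.
Qed.

(** A single odd variable leaves no two distinct odd factors to exchange. *)
Lemma koszul1 A B : koszul K A B = 1.
Proof.
rewrite /koszul (_ : [set u | _] = set0) ?cards0 //.
by apply/setP => -[i j]; rewrite !inE /= (ord1 i) (ord1 j) ltnn !andbF.
Qed.

Lemma comulU a : comul (<< a >> : U) =
  \sum_(b : {dffun forall i : 'I_p, 'I_(a i).+1})
     << ([ffun i => nat_of_ord (b i)] : M, [ffun i => (a i - b i)%N] : M) >>.
Proof. by rewrite /comul lextU. Qed.

(** The binomial coefficients of the coproduct are absorbed by the factorials of the divided
    powers. *)
Lemma afact_bin a (b : {dffun forall i : 'I_p, 'I_(a i).+1}) :
  (afact a)^-1 * (\prod_i 'C(a i, b i))%:R =
  (afact [ffun i => nat_of_ord (b i)])^-1 * (afact [ffun i => (a i - b i)%N])^-1 :> K.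
Proof.
have -> : afact a = (\prod_i 'C(a i, b i))%:R *
    (afact [ffun i => nat_of_ord (b i)] * afact [ffun i => (a i - b i)%N]) :> K.
  rewrite /afact -!natrM -!big_split /=; congr (_%:R); apply: eq_bigr => i _.
  by rewrite !ffunE bin_fact // -ltnS ltn_ord.
rewrite invfM mulrAC mulVf ?mul1r ?invfM //.
rewrite (proj1 (pcharf0P K) char0) -lt0n; apply: prodn_gt0 => i.
by rewrite bin_gt0 -ltnS ltn_ord.
Qed.

Lemma scom_smonE a A : scom (smonE K (a, A) : S) =
  \sum_(b : {dffun forall i : 'I_p, 'I_(a i).+1}) \sum_(B in powerset A)
    (\prod_i 'C(a i, b i))%:R *:
      tens (smonE K ([ffun i => nat_of_ord (b i)], B) : S)
           (smonE K ([ffun i => (a i - b i)%N], A :\: B) : S).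
Proof.
have [e|/smonE_neq[m em ->]] := eqVneq (a, A) (smon0 p 1).
  (* The empty monomial is 0 in S(W), and every term on the right contains it as a factor. *)
  rewrite e smonE_m0 linear0 big1 // => b _; rewrite big1 // => B.
  case: e => ea eA; rewrite eA powerset0 inE => /eqP ->.
  rewrite (_ : [ffun i => nat_of_ord (b i)] = m0) ?smonE_m0 ?tens0l ?scaler0 //.
  apply/ffunP => i; rewrite !ffunE; have a0 : a i = 0%N by rewrite ea ffunE.
  have : (b i <= a i)%N by rewrite -ltnS.
  by rewrite [X in (_ <= X)%N]a0 leqn0 => /eqP.
rewrite /scom lextU /scomul_mon em /=; apply: eq_bigr => b _; apply: eq_bigr => B _.
by rewrite koszul1 mulr1 stensE.
Qed.

Lemma tmap_bigsum (C D C' D' : choiceType) (f : {malg K[C]} -> {malg K[C']})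
    (g : {malg K[D]} -> {malg K[D']}) I (r : seq I) (F : I -> malg2 K C D) :
  tmap f g (\sum_(i <- r) F i) = \sum_(i <- r) tmap f g (F i).
Proof. exact: linear_sum. Qed.

Lemma tmap_inj_bin a (b : {dffun forall i : 'I_p, 'I_(a i).+1}) A B :
  tmap (inj A) (inj B) << ([ffun i => nat_of_ord (b i)] : M, [ffun i => (a i - b i)%N] : M) >> =
  (afact a)^-1 *: ((\prod_i 'C(a i, b i))%:R *:
    tens (smonE K ([ffun i => nat_of_ord (b i)], A) : S)
         (smonE K ([ffun i => (a i - b i)%N], B) : S)).
Proof. by rewrite tmapU !injU tensZl tensZr !scalerA -afact_bin. Qed.

Lemma sum_powersetT (V : nmodType) (F : {set 'I_1} -> {set 'I_1} -> V) :
  \sum_(B in powerset setT) F B (setT :\: B) = F setT set0 + F set0 setT.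
Proof.
rewrite (bigD1 setT) ?powersetE ?subsetT //= (bigD1 set0) /=; last first.
  by rewrite powersetE sub0set eq_sym setT1_neq0.
rewrite setDv setD0 big1 ?addr0 // => B.
by have [->|->] := set1E B; rewrite eqxx ?andbF.
Qed.

Lemma scom_inj0 x : scom (inj set0 x) = tmap (inj set0) (inj set0) (comul x).
Proof.
elim/malg_lin_ind: x => [|e x z IHx IHz|a]; first by rewrite !linear0.
  by rewrite !linear_PZ /= IHx IHz.
rewrite comulU linear_sum injU linear_Z /= scom_smonE.
rewrite scaler_sumr; apply: eq_bigr => b _ /=.
by rewrite powerset0 big_set1 setD0 tmap_inj_bin.
Qed.

(** As t is primitive, the coproduct of x t is that of x times t (x) 1 + 1 (x) t. *)
Lemma scom_injT x : scom (inj setT x) =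
  tmap (inj setT) (inj set0) (comul x) + tmap (inj set0) (inj setT) (comul x).
Proof.
pose F : {linear U -> S2} := scom \o inj setT.
pose G : {linear U -> S2} :=
  (tmap (inj setT) (inj set0) \o @comul K p) \+ (tmap (inj set0) (inj setT) \o @comul K p).
apply: (malg_ext (f := F) (g := G)) => a; rewrite /F /G /=.
rewrite comulU [X in _ = X + _]tmap_bigsum [X in _ = _ + X]tmap_bigsum.
rewrite injU linear_Z /= scom_smonE scaler_sumr -big_split; apply: eq_bigr => b _ /=.
rewrite (sum_powersetT (fun B C => (\prod_i 'C(a i, b i))%:R *:
  tens (smonE K ([ffun i => nat_of_ord (b i)], B) : S)
       (smonE K ([ffun i => (a i - b i)%N], C) : S))).
rewrite [X in _ = X + _]tmap_inj_bin [X in _ = _ + X]tmap_inj_bin.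
exact: scalerDr.
Qed.

End OneOddVariable.

(** * Operators on S(W) built from operators on U *)

Section Transfer.
Variables (K : fieldType) (p : nat).
Hypothesis char0 : [pchar K] =i pred0.
Local Notation M := {ffun 'I_p -> nat}.
Local Notation U := {malg K[M]}.
Local Notation S := {malg K[smon p 1]}.
Local Notation S2 := (malg2 K (smon p 1) (smon p 1)).
Local Notation inj0 := (@inj K p set0).
Local Notation inj1 := (@inj K p setT).
Local Notation prj0 := (@prj K p set0).
Local Notation prj1 := (@prj K p setT).
Implicit Types (a b c : M) (A B : {set 'I_1}) (x : U) (y : S).

Lemma inj_ext (V : lmodType K) (f g : {linear S -> V}) :
  (forall x, f (inj0 x) = g (inj0 x)) -> (forall x, f (inj1 x) = g (inj1 x)) -> f =1 g.
Proof. by move=> e0 e1 y; rewrite (inj_prj char0 y) !linearD e0 e1. Qed.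

Let n0T : (set0 : {set 'I_1}) != setT.
Proof. by rewrite eq_sym setT1_neq0. Qed.

Lemma prj00 x : prj0 (inj0 x) = pos x. Proof. by []. Qed.
Lemma prj11 x : prj1 (inj1 x) = x. Proof. exact: prj_inj_T. Qed.
Lemma prj01 x : prj0 (inj1 x) = 0.
Proof. exact: prj_inj_neq. Qed.
Lemma prj10 x : prj1 (inj0 x) = 0.
Proof. by rewrite prj_inj_neq // setT1_neq0. Qed.

Lemma scoef_val y (n : smon p 1) : scoef y (val n) = y@_n.
Proof. by rewrite /scoef valK. Qed.

Lemma sparityE (n : smon p 1) : sparity n = ((val n).2 != set0).
Proof.
rewrite /sparity; have [->|->] := set1E (val n).2; first by rewrite cards0 eqxx.
by rewrite cardsT card_ord setT1_neq0.
Qed.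

Lemma prj_coef A y (n : smon p 1) : (val n).2 = A ->
  y@_n = (afact (val n).1)^-1 * (prj A y)@_((val n).1).
Proof.
move=> <-; rewrite prjE mulrA mulVf ?afact_neq0 // mul1r -surjective_pairing.
by rewrite scoef_val.
Qed.

Lemma inj_sparity A x n : (inj A x)@_n != 0 -> sparity n = (A != set0).
Proof.
rewrite sparityE; have [->//|nA] := eqVneq (val n).2 A.
by rewrite (prj_coef _ erefl) prj_inj_neq // mcoeff0 mulr0 eqxx.
Qed.

Lemma prjU_neq A (m : smon p 1) : (val m).2 != A -> prj A (<< m >> : S) = 0.
Proof. by move=> nA; rewrite prjU (negPf nA). Qed.

Lemma smapD k (f g : S -> S) (z w : S2) : smap k f g (z + w) = smap k f g z + smap k f g w.
Proof. exact: linearD. Qed.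

Lemma tmapD (C D C' D' : choiceType) (f : {malg K[C]} -> {malg K[C']})
    (g : {malg K[D]} -> {malg K[D']}) (z w : malg2 K C D) :
  tmap f g (z + w) = tmap f g z + tmap f g w.
Proof. exact: linearD. Qed.

Lemma addr_cancel_mid (V : zmodType) (u v w : V) : u + v = (u + w) + (- w + v).
Proof. by rewrite addrA addrK. Qed.

Definition dmap (V H : U -> U) y : S := inj0 (V (prj1 y)) + inj1 (H (prj0 y)).
HB.instance Definition _ (V H : {linear U -> U}) := GRing.Linear.copy (dmap V H)
  ((inj0 \o (V \o prj1)) \+ (inj1 \o (H \o prj0))).

Lemma linear_pos (H : {linear U -> U}) x : H << m0 >> = 0 -> H (pos x) = H x.
Proof. by move=> H0; rewrite posE // linearB linearZ /= H0 scaler0 subr0. Qed.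

Lemma dmap1 (V H : {linear U -> U}) x : dmap V H (inj1 x) = inj0 (V x).
Proof. by rewrite /dmap prj11 prj01 (linear0 H) linear0 addr0. Qed.

(** As [inj0] kills the constant 1, H has to kill it too. *)
Lemma dmap0 (V H : {linear U -> U}) x : H << m0 >> = 0 -> dmap V H (inj0 x) = inj1 (H x).
Proof. by move=> H0; rewrite /dmap prj10 (linear0 V) linear0 add0r prj00 linear_pos. Qed.

Lemma dmap_homog (V H : {linear U -> U}) : @homog K p 1 true (dmap V H).
Proof.
move=> m n; rewrite [sparity m]sparityE /dmap.
have [e|e] := set1E (val m).2.
  rewrite e eqxx (prjU_neq (A := setT)) ?e ?n0T //.
  by rewrite (linear0 V) linear0 add0r => /inj_sparity ->; rewrite setT1_neq0.
rewrite e setT1_neq0 (prjU_neq (A := set0)) ?e ?setT1_neq0 //.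
by rewrite (linear0 H) linear0 addr0 => /inj_sparity ->; rewrite eqxx.
Qed.

Section Components.
Variables (D : {linear S -> S}) (V H : {linear U -> U}).
Hypotheses (D0 : forall x, D (inj0 x) = inj1 (H x)) (D1 : forall x, D (inj1 x) = inj0 (V x)).

Lemma smap_sum0 x :
  smap false D idfun (scom (inj0 x)) + smap true idfun D (scom (inj0 x)) =
  tmap inj1 inj0 (tmap H idfun (comul x)) + tmap inj0 inj1 (tmap idfun H (comul x)).
Proof.
rewrite scom_inj0 //; congr (_ + _).
  by rewrite smap_inj tmap_comp scale1r; apply: eq_tmap.
by rewrite smap_inj tmap_comp eqxx scale1r; apply: eq_tmap.
Qed.

(** The minus sign arises where the odd D passes the factor t in the left slot. *)
Lemma smap_sum1 x :
  smap false D idfun (scom (inj1 x)) + smap true idfun D (scom (inj1 x)) =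
  (tmap inj0 inj0 (tmap V idfun (comul x)) + tmap inj1 inj1 (tmap H idfun (comul x))) +
  (- tmap inj1 inj1 (tmap idfun H (comul x)) + tmap inj0 inj0 (tmap idfun V (comul x))).
Proof.
rewrite scom_injT // !smapD; congr ((_ + _) + (_ + _)).
- by rewrite smap_inj tmap_comp scale1r; apply: eq_tmap.
- by rewrite smap_inj tmap_comp scale1r; apply: eq_tmap.
- by rewrite smap_inj tmap_comp setT1_neq0 expr1 scaleN1r; congr (- _); apply: eq_tmap.
- by rewrite smap_inj tmap_comp eqxx scale1r; apply: eq_tmap.
Qed.

End Components.

Lemma dmap_scom (V H : {linear U -> U}) : coder V -> contr H -> H << m0 >> = 0 ->
  forall y, scom (dmap V H y) =
    smap false (dmap V H) idfun (scom y) + smap true idfun (dmap V H) (scom y).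
Proof.
move=> cV cH H0; pose D : {linear S -> S} := dmap V H.
pose F : {linear S -> S2} := @scom K p \o D.
pose G : {linear S -> S2} := (smap false D idfun \o @scom K p) \+ (smap true idfun D \o @scom K p).
have D0 x : D (inj0 x) = inj1 (H x) by apply: dmap0.
have D1 x : D (inj1 x) = inj0 (V x) by apply: dmap1.
apply: (inj_ext (f := F) (g := G)) => x; rewrite /F /G [LHS]/= [RHS]/=.
  by rewrite (smap_sum0 D0) D0 scom_injT // cH -(contr_r x cH) cH.
rewrite (smap_sum1 D0 D1) D1 scom_inj0 // -cH -(contr_r x cH) cV tmapD.
(* The two terms with t in both factors cancel, since H may act on either side. *)
exact: addr_cancel_mid.
Qed.

Lemma dmap_codifferential (V H : {linear U -> U}) :
  coder V -> contr H -> H << m0 >> = 0 ->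
  (forall x, V (H x) = 0) -> (forall x, H (V x) = 0) ->
  @codifferential K p 1 (dmap V H).
Proof.
move=> cV cH H0 VH HV; pose D : {linear S -> S} := dmap V H; split; first split.
- exact: dmap_homog.
- by move=> y; rewrite !stensmapE !scomulE; apply: dmap_scom.
have DD y : D (D y) = 0.
  apply: (inj_ext (f := D \o D) (g := \0 : S -> S)) => x /=.
    by rewrite /D /= dmap0 // dmap1 VH linear0.
  by rewrite /D /= dmap1 dmap0 // HV linear0.
by move=> y; rewrite /cobracket [_ (_ y)]DD scaler0 subr0.
Qed.

(** Up to constants this is G tensored with the identity on the span of 1 and t: the odd coordinate
    stays fixed. *)
Definition gmap (G : U -> U) y : S := inj0 (G (prj0 y)) + inj1 (G (prj1 y)).
HB.instance Definition _ (G : {linear U -> U}) := GRing.Linear.copy (gmap G)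
  ((inj0 \o (G \o prj0)) \+ (inj1 \o (G \o prj1))).

Lemma gmap1 (G : {linear U -> U}) x : gmap G (inj1 x) = inj1 (G x).
Proof. by rewrite /gmap prj11 prj01 (linear0 G) linear0 add0r. Qed.

Lemma gmap0 (G : {linear U -> U}) x : G << m0 >> = << m0 >> ->
  gmap G (inj0 x) = inj0 (G x).
Proof.
move=> G0; rewrite /gmap prj10 (linear0 G) linear0 addr0 prj00 posE //.
by rewrite linearB linearZ /= G0 linearB linearZ /= inj_m0 scaler0 subr0.
Qed.

Lemma gmapK (G G' : {linear U -> U}) : cancel G G' -> G << m0 >> = << m0 >> ->
  G' << m0 >> = << m0 >> -> cancel (gmap G) (gmap G').
Proof.
move=> GK G0 G0' y.
apply: (inj_ext (f := gmap G' \o gmap G) (g := idfun)) => x /=.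
  by rewrite !gmap0 // GK.
by rewrite !gmap1 GK.
Qed.

Lemma gmap_coalg_aut (G G' : {linear U -> U}) :
  cancel G G' -> cancel G' G -> coalg G -> G << m0 >> = << m0 >> ->
  @coalg_aut K p 1 (gmap G) (gmap G').
Proof.
move=> GK G'K cG G0; have G0' : G' << m0 >> = << m0 >> by rewrite -{1}G0 GK.
split; [move=> m n|move=> y|exact: gmapK|exact: gmapK].
  rewrite [sparity m]sparityE /= /gmap; have [e|e] := set1E (val m).2.
    rewrite e (prjU_neq (A := setT)) ?e ?n0T //.
    by rewrite (linear0 G) linear0 addr0 => /inj_sparity ->; rewrite eqxx.
  rewrite e (prjU_neq (A := set0)) ?e ?setT1_neq0 //.
  by rewrite (linear0 G) linear0 add0r => /inj_sparity ->; rewrite setT1_neq0.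
rewrite !stensmapE !scomulE; pose g : {linear S -> S} := gmap G.
have g0 : g \o inj0 =1 inj0 \o G by move=> x; apply: gmap0.
have g1 : g \o inj1 =1 inj1 \o G by move=> x; apply: gmap1.
apply: (inj_ext (f := @scom K p \o g) (g := smap false g g \o @scom K p)) => x /=.
  rewrite [gmap G _]g0 /= !scom_inj0 // (smap_inj false g g) scale1r cG tmap_comp.
  exact: eq_tmap.
rewrite [gmap G _]g1 /= !scom_injT // smapD !(smap_inj false g g) /= !scale1r.
by rewrite cG !tmap_comp; congr (_ + _); apply: eq_tmap.
Qed.

Lemma coequiv_dmap (d : {linear S -> S}) (V H V' H' G G' : {linear U -> U}) :
  d =1 dmap V H -> H << m0 >> = 0 -> H' << m0 >> = 0 ->
  cancel G G' -> cancel G' G -> coalg G -> G << m0 >> = << m0 >> ->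
  (forall x, V (G x) = G (V' x)) -> (forall x, H (G x) = G (H' x)) ->
  @coequiv K p 1 d (dmap V' H').
Proof.
move=> dE H0 H0' GK G'K cG G0 VG HG; have aG := gmap_coalg_aut GK G'K cG G0.
exists (gmap G), (gmap G'); split=> // y; have [_ _ gK giK] := aG.
apply: (can_inj gK); rewrite giK [d _]dE.
apply: (inj_ext (f := gmap G \o dmap V' H') (g := dmap V H \o gmap G)) => x /=.
  by rewrite dmap0 // gmap1 gmap0 // dmap0 // HG.
by rewrite dmap1 gmap0 // gmap1 dmap1 VG.
Qed.

End Transfer.

(** * The operators V and H of a codifferential, and its linear term *)

Section Linearization.
Variables (K : fieldType) (p : nat).
Hypothesis char0 : [pchar K] =i pred0.
Local Notation M := {ffun 'I_p -> nat}.
Local Notation U := {malg K[M]}.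
Local Notation S := {malg K[smon p 1]}.
Local Notation inj0 := (@inj K p set0).
Local Notation inj1 := (@inj K p setT).
Local Notation prj0 := (@prj K p set0).
Local Notation prj1 := (@prj K p setT).
Implicit Types (a b c : M) (A B : {set 'I_1}) (x : U) (y : S).

Lemma prj0_m0 y : (prj0 y)@_m0 = 0.
Proof. by rewrite prjE /scoef insubF ?mulr0 //= eqxx. Qed.

Lemma scoef_prj A y a : scoef y (a, A) = (afact a)^-1 * (prj A y)@_a.
Proof. by rewrite prjE mulrA mulVf ?mul1r // afact_neq0. Qed.

Lemma homog_prj A (d : {linear S -> S}) x :
  @homog K p 1 true d -> prj A (d (inj A x)) = 0.
Proof.
move=> hd; elim/malg_lin_ind: x => [|e x z IHx IHz|a].
- by rewrite [inj A 0]linear0 [d 0]linear0 linear0.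
- by rewrite !linear_PZ /= IHx IHz scaler0 addr0.
rewrite injU !linear_Z /=.
have [e|/(smonE_neq K)[m em ->]] := eqVneq (a, A) (smon0 p 1).
  by rewrite e smonE_m0 [d 0]linear0 linear0 scaler0.
rewrite [prj A _](_ : _ = 0) ?scaler0 //.
apply/malgP => b; rewrite prjE mcoeff0; apply/eqP; rewrite mulf_eq0; apply/orP; right.
rewrite /scoef; case: insubP => [n _ en|_]; rewrite [oapp _ _ _]/= ?eqxx //.
apply: contraT => /hd; rewrite !sparityE en em /=.
by case: (A != set0).
Qed.

(** [pos] affects only constant coefficients, so the coefficients at two nonconstant monomials
    survive it. *)
Lemma tmap_pos_coef (z w : malg2 K M M) b c : b != m0 -> c != m0 ->
  tmap (@pos K p) (@pos K p) z = tmap (@pos K p) (@pos K p) w -> z@_(b, c) = w@_(b, c).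
Proof.
move=> nb nc; have E t : (tmap (@pos K p) (@pos K p) t)@_(b, c) = t@_(b, c).
  have -> : tmap (@pos K p) (@pos K p) t = tmap (@pos K p) idfun (tmap idfun (@pos K p) t).
    by rewrite tmap_comp.
  by rewrite tmapEl pos_coef // sliceRE tmapEr pos_coef // sliceLE.
by move=> e; rewrite -(E z) e E.
Qed.

Lemma tmap_id_pos_coef (z w : malg2 K M M) b c : c != m0 ->
  tmap idfun (@pos K p) z = tmap idfun (@pos K p) w -> z@_(b, c) = w@_(b, c).
Proof.
move=> nc; have E t : (tmap idfun (@pos K p) t)@_(b, c) = t@_(b, c).
  by rewrite tmapEr pos_coef // sliceLE.
by move=> e; rewrite -(E z) e E.
Qed.

Lemma tmap_prj_inj (A B C D : {set 'I_1}) z :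
  tmap (@prj K p A) (@prj K p B) (tmap (@inj K p C) (@inj K p D) z) =
  tmap (@prj K p A \o @inj K p C) (@prj K p B \o @inj K p D) z.
Proof. exact: tmap_comp. Qed.

Lemma tmap_eq0l (X Y X' Y' : choiceType) (f : {malg K[X]} -> {malg K[X']})
    (g : {malg K[Y]} -> {malg K[Y']}) z : (forall u, f u = 0) -> tmap f g z = 0.
Proof.
move=> f0; elim/malg_lin_ind: z => [|e z w IHz IHw|[a b]].
- exact: linear0.
- by rewrite linear_PZ /= IHz IHw scaler0 addr0.
by rewrite tmapU f0 tens0l.
Qed.

Section Components.
Variables (d : {linear S -> S}).
Hypothesis hd : @codifferential K p 1 d.

Definition evenpart : {linear U -> U} := prj0 \o (d \o inj1).
Definition oddpart : {linear U -> U} := prj1 \o (d \o inj0).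
Local Notation V := evenpart.
Local Notation H := oddpart.

Let d0 x : d (inj0 x) = inj1 (H x).
Proof.
have [[hom _] _] := hd.
by rewrite [LHS](inj_prj char0) (homog_prj _ _ hom) linear0 add0r.
Qed.

Let d1 x : d (inj1 x) = inj0 (V x).
Proof.
have [[hom _] _] := hd.
by rewrite [LHS](inj_prj char0) (homog_prj _ _ hom) linear0 addr0.
Qed.

(* These two discharge the side conditions of [prj_inj_neq] below. *)
Let nT0 : (setT : {set 'I_1}) != set0 := setT1_neq0.
Let n0T : (set0 : {set 'I_1}) != setT.
Proof. by rewrite eq_sym. Qed.

Lemma evenpart_m0 x : (V x)@_m0 = 0.
Proof. exact: prj0_m0. Qed.

Lemma oddpart_m0 : H << m0 >> = 0.
Proof. by rewrite /oddpart /= inj_m0 [d 0]linear0 linear0. Qed.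

Lemma dmap_parts : d =1 dmap V H.
Proof.
apply: (inj_ext char0 (f := d) (g := dmap V H)) => x.
  by rewrite d0 [RHS]dmap0 //; exact: oddpart_m0.
by rewrite d1 [RHS]dmap1.
Qed.

Let scom_d y : scom (d y) = smap false d idfun (scom y) + smap true idfun d (scom y).
Proof. by have [[_ h] _] := hd; have := h y; rewrite !scomulE !stensmapE. Qed.

(** The component in U t (x) U of the coderivation rule at x in U gives the identity up to constants
    in the right factor; there it is trivial. *)
Lemma oddpart_contr : contr H.
Proof.
apply/contrP => x b c; have [->|nc] := eqVneq c m0; first by rewrite madd0 shift0.
rewrite -comulE -tmapEl; apply: tmap_id_pos_coef nc _.
have := scom_d (inj0 x); rewrite (smap_sum0 char0 d0) d0 scom_injT //.
move=> /(congr1 (tmap prj1 prj0)); rewrite !tmapD !tmap_prj_inj.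
have Z t : tmap (prj1 \o inj0) (prj0 \o inj1) t = 0.
  by apply: tmap_eq0l => z; apply: prj_inj_neq.
have E t : tmap (prj1 \o inj1) (prj0 \o inj0) t = tmap idfun (@pos K p) t.
  by apply: eq_tmap => z //=; apply: prj_inj_T.
by rewrite !Z !addr0 !E.
Qed.

(** The component in U (x) U of the coderivation rule at x t gives the identity at nonconstant [b]
    and [c]; the other cases hold because the values of V have no constant term. *)
Lemma evenpart_coder : coder V.
Proof.
apply/coderP => x b c.
have [->|nb] := eqVneq b m0; first by rewrite madd0m shift0 evenpart_m0 add0r.
have [->|nc] := eqVneq c m0; first by rewrite madd0 shift0 evenpart_m0 addr0.
rewrite -comulE -tmapEl.
have -> : (V (shift b x))@_c = (tmap idfun V (comul x))@_(b, c).
  by rewrite tmapEr sliceL_comul.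
rewrite -mcoeffD; apply: tmap_pos_coef nb nc _.
have := scom_d (inj1 x); rewrite (smap_sum1 char0 d0 d1) d1 scom_inj0 //.
move=> /(congr1 (tmap prj0 prj0)).
rewrite -[- tmap _ _ _]scaleN1r !tmapD [tmap prj0 prj0 (_ *: _)]linear_Z /= !tmap_prj_inj.
have Z t : tmap (prj0 \o inj1) (prj0 \o inj1) t = 0.
  by apply: tmap_eq0l => z; apply: prj_inj_neq.
by rewrite !Z scaler0 addr0 add0r.
Qed.

Let dd y : d (d y) = 0.
Proof.
(* For odd d, [d, d] = 2 d d, and 2 is invertible. *)
have [_ h] := hd; have := h y; rewrite /cobracket expr1 scaleN1r opprK => /eqP.
rewrite -mulr2n -scaler_nat scaler_eq0 (proj1 (pcharf0P K) char0) /=.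
by move/eqP.
Qed.

Lemma evenpart_oddpart x : V (H x) = 0.
Proof.
have := dd (inj0 x); rewrite d0 d1 => /(congr1 prj0).
by rewrite linear0 -[LHS]/(pos (V (H x))) pos_id // evenpart_m0.
Qed.

Lemma oddpart_evenpart x : H (V x) = 0.
Proof.
have := dd (inj1 x); rewrite d1 d0 => /(congr1 prj1).
by rewrite linear0 (prj_inj_T char0).
Qed.

End Components.

Lemma lext_restrict (A : choiceType) (P : pred A) (z : {malg K[A]}) m :
  (lext (fun k => if P k then << k >> else 0 : {malg K[A]}) z)@_m = if P m then z@_m else 0.
Proof.
elim/malg_lin_ind: z => [|e y z IHy IHz|k].
- by rewrite linear0 mcoeff0; case: (P m).
- rewrite linear_PZ mcoeffD mcoeffZ IHy IHz.
  by case: (P m); rewrite ?mcoeffD ?mcoeffZ // mulr0 addr0.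
rewrite lextU; case: (eqVneq k m) => [->|nkm]; first by case: (P m); rewrite ?mcoeff0.
by case: (P k); case: (P m); rewrite ?mcoeff0 ?mcoeffU ?(negPf nkm).
Qed.

Lemma sprojE n y (m : smon p 1) : (sproj n y)@_m = if sdeg m == n then y@_m else 0.
Proof.
have -> : sproj n y = lext (fun m => if sdeg m == n then << m >> else 0 : S) y.
  transitivity (\sum_(k <- msupp y | sdeg k == n) y@_k *: << k >> : S); first reflexivity.
  rewrite lext.unlock [LHS]big_mkcond; apply: eq_bigr => k _.
  by case: ifP => _; [reflexivity|rewrite scaler0].
exact: lext_restrict.
Qed.

Lemma prj_sproj A n y a :
  (prj A (sproj n y))@_a = if (wdeg a + #|A| == n)%N then (prj A y)@_a else 0.
Proof.
rewrite !prjE /scoef; case: insubP => [m _ em|_]; last by rewrite mulr0; case: ifP.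
rewrite [oapp _ _ _]/= sprojE (_ : sdeg m = wdeg a + #|A|)%N.
  by case: ifP => // _; rewrite mulr0.
by rewrite /sdeg em.
Qed.

Lemma prj1_sproj1 y : prj1 (sproj 1 y) = (prj1 y)@_m0 *: << m0 >>.
Proof.
apply/malgP => a; rewrite prj_sproj cardsT card_ord addn1 eqSS mcoeffZ mcoeffU.
have [<-|na] := eqVneq m0 a; first by rewrite wdeg0 mulr1.
by rewrite mulr0; case: eqP => // /wdeg_eq0 e; rewrite e eqxx in na.
Qed.

Lemma prj0_sproj1 y : prj0 (sproj 1 y) = \sum_k (prj0 y)@_(mX k) *: << mX k >>.
Proof.
have b2 : below 2 (prj0 (sproj 1 y)).
  by move=> a; rewrite prj_sproj cards0 addn0; case: (eqVneq (wdeg a)) => [->//|_]; rewrite eqxx.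
rewrite (below2 b2) prj0_m0 scale0r add0r; apply: eq_bigr => k _.
by rewrite prj_sproj cards0 addn0 wdegX.
Qed.

Lemma vec0_eq0 (V : {linear U -> U}) : (forall x, V x = 0) -> forall x, tv (vec0 V) x = 0.
Proof.
move=> V0 x; apply/malgP => a; rewrite tvE mcoeff0 big1 // => k _.
by rewrite /vec0 V0 mcoeff0 !mul0r.
Qed.

Lemma form1_eq0 (H : {linear U -> U}) : (forall x, H x = 0) -> forall x, dl (form1 H) x = 0.
Proof.
move=> H0 x; apply/malgP => a; rewrite dlE mcoeff0 big1 // => k _.
by rewrite /form1 H0 mcoeff0 !mul0r.
Qed.

Lemma dl_m0 (l : 'I_p -> K) : dl l << m0 >> = 0.
Proof. by apply/below_0/(@dl_lowers K p l 1)/belowU; rewrite wdeg0. Qed.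

(** The result in coordinates, for any number of even variables. *)
Lemma linearize (d : {linear symc K p 1 -> symc K p 1}) : codifferential d ->
  (exists y, (exists i, scoef (d (sproj 1 y)) (mX i, set0) != 0) \/
             exists j, scoef (d (sproj 1 y)) (m0, [set j]) != 0) ->
  exists d1 : {linear symc K p 1 -> symc K p 1},
  [/\ forall y i, scoef (d1 y) (mX i, set0) = scoef (d (sproj 1 y)) (mX i, set0),
      forall y j, scoef (d1 y) (m0, [set j]) = scoef (d (sproj 1 y)) (m0, [set j]),
      codifferential d1 & coequiv d d1].
Proof.
move=> hd hlead; pose d' : {linear S -> S} := d.
have {}hd : @codifferential K p 1 d' := hd.
pose V := evenpart d'; pose H := oddpart d'.
have cV : coder V := evenpart_coder hd.
have cH : contr H := oddpart_contr hd.
have H0 : H << m0 >> = 0 := oddpart_m0 d'.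
have VH x : V (H x) = 0 := evenpart_oddpart hd x.
have HV x : H (V x) = 0 := oddpart_evenpart hd x.
have dE : d' =1 dmap V H := dmap_parts hd.
pose T := tv (vec0 V); pose L := dl (form1 H).
have cT : coder T by apply: tv_coder.
have cL : contr L by apply: dl_contr.
have L0 : L << m0 >> = 0 by apply: dl_m0.
have setj (j : 'I_1) : [set j] = setT by apply/setP => i; rewrite !inE !ord1.
have P0 (V' H' : {linear U -> U}) y : (forall x, (V' x)@_m0 = 0) ->
    prj0 (dmap V' H' y) = V' (prj1 y).
  move=> V'0; rewrite /dmap linearD /= [X in _ + X]prj_inj_neq ?addr0.
    by rewrite -[LHS]/(pos _) pos_id.
  by rewrite eq_sym setT1_neq0.
have P1 (V' H' : {linear U -> U}) y : prj1 (dmap V' H' y) = H' (prj0 y).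
  rewrite /dmap linearD /= [X in X + _]prj_inj_neq ?add0r ?setT1_neq0 //.
  exact: prj_inj_T.
(* The degree 1 term sends t to the vector [vec0 V] and an even vector w to l(w) t with l =
   [form1 H]; [C0] and [C1] are its coordinates. *)
have C0 y i : scoef (d' (sproj 1 y)) (mX i, set0) = vec0 V i * (prj1 y)@_m0.
  rewrite scoef_prj afact_mX invr1 mul1r dE P0; last exact: evenpart_m0.
  by rewrite prj1_sproj1 linear_Z mcoeffZ mulrC.
have C1 y j : scoef (d' (sproj 1 y)) (m0, [set j]) =
    \sum_k form1 H k * (prj0 y)@_(mX k).
  rewrite setj scoef_prj afact_m0 invr1 mul1r dE P1 prj0_sproj1 linear_sum raddf_sum /=.
  by apply: eq_bigr => k _; rewrite !linear_Z /= mcoeffZ mulrC.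
exists (dmap T L).
have nz : (exists k, vec0 V k != 0) \/ (exists k, form1 H k != 0).
  case: hlead => y [] [j]; first rewrite C0 mulf_eq0 negb_or => /andP[vj _].
    by left; exists j.
  rewrite C1 => nz; right; apply/existsP; apply: contraT => /existsPn h.
  by move: nz; rewrite big1 ?eqxx // => k _; move: (h k) => /negPn/eqP ->; rewrite mul0r.
have [TL LT equiv] : [/\ forall x, T (L x) = 0, forall x, L (T x) = 0 &
    @coequiv K p 1 d' (dmap T L)].
  (* In either case one operator is straightened, and the other vanishes together with its linear
     part. *)
  case: nz => nz.
    have [Hx [G [G' [GK G'K cG G0 VG]]]] := straighten_coder char0 cV nz VH.
    have L_0 := form1_eq0 Hx; split=> [x|x|]; rewrite ?[L _]L_0 ?[T 0]linear0 //.
    apply: (coequiv_dmap char0 dE H0 L0 GK G'K cG G0 VG) => x.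
    by rewrite Hx; apply: esym; rewrite -(linear0 G); congr (G _); apply: L_0.
  have [Vx [G [G' [GK G'K cG G0 HG]]]] := straighten_contr char0 cH H0 nz VH.
  have T_0 := vec0_eq0 Vx; split=> [x|x|]; rewrite ?[T _]T_0 ?[L 0]linear0 //.
  apply: (coequiv_dmap char0 dE H0 L0 GK G'K cG G0 _ HG) => x.
  by rewrite Vx; apply: esym; rewrite -(linear0 G); congr (G _); apply: T_0.
split=> [y i|y j||]; last exact: equiv.
- rewrite [RHS]C0 scoef_prj afact_mX invr1 mul1r [prj0 _]P0; last exact: tv_m0.
  exact: tv_mX.
- rewrite [RHS]C1 setj scoef_prj afact_m0 invr1 mul1r [prj1 _]P1 dlE.
  by apply: eq_bigr => k _; rewrite madd0m.
- exact: dmap_codifferential.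
Qed.

End Linearization.

(** * Return from coordinates to W *)

Theorem mainTheorem1 (R : realType) (W : vectType R[i]) (W0 W1 : {vspace W})
    (hsum : (W0 + W1)%VS = fullv) (hdir : (W0 :&: W1)%VS = 0%VS)
    (hdim0 : \dim W0 = 2%N) (hdim1 : \dim W1 = 1%N)
    (d : {linear symc R[i] (\dim W0) (\dim W1) -> symc R[i] (\dim W0) (\dim W1)})
    (hd : codifferential d)
    (hlead : exists x, component W0 W1 1 d x != 0) :
  exists d1 : {linear symc R[i] (\dim W0) (\dim W1) ->
                      symc R[i] (\dim W0) (\dim W1)},
    [/\ forall x, scorestr W0 W1 (d1 x) = component W0 W1 1 d x,
        codifferential d1 &
        coequiv d d1].
Proof.
have char0 : [pchar R[i]] =i pred0 by apply: pchar_num.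
(* The type of [d] depends on [\dim W1], so the odd dimension is first made a variable [q] in which
   1 can be substituted. *)
have key q (d' : {linear symc R[i] (\dim W0) q -> symc R[i] (\dim W0) q}) :
  q = 1%N -> codifferential d' ->
  (exists y, (exists i, scoef (d' (sproj 1 y)) (mX i, set0) != 0) \/
             exists j, scoef (d' (sproj 1 y)) (m0, [set j]) != 0) ->
  exists d1 : {linear symc R[i] (\dim W0) q -> symc R[i] (\dim W0) q},
  [/\ forall y i, scoef (d1 y) (mX i, set0) = scoef (d' (sproj 1 y)) (mX i, set0),
      forall y j, scoef (d1 y) (m0, [set j]) = scoef (d' (sproj 1 y)) (m0, [set j]),
      codifferential d1 & coequiv d' d1].
  by move=> eq1; rewrite {q}eq1 in d' *; apply: linearize.
have [|d1 [e0 e1 cd1 eq1]] := key _ d hdim1 hd.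
  (* If all coordinates of the degree 1 term vanished at [y], then so would its value in W. *)
  case: hlead => y ny; exists y.
  case: (boolP [exists i, scoef (d (sproj 1 y)) (mX i, set0) != 0]) => [/existsP|/existsPn h0].
    by left.
  case: (boolP [exists j, scoef (d (sproj 1 y)) (m0, [set j]) != 0]) => [/existsP|/existsPn h1].
    by right.
  move: ny; rewrite /component /scorestr big1 => [|i _]; last first.
    by have /negPn/eqP -> := h0 i; rewrite scale0r.
  rewrite big1 ?addr0 ?eqxx // => j _.
  by have /negPn/eqP -> := h1 j; rewrite scale0r.
exists d1; split=> // y; rewrite /component /scorestr; congr (_ + _).
  by apply: eq_bigr => i _; rewrite [in LHS]e0.
by apply: eq_bigr => j _; rewrite [in LHS]e1.
Qed.
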